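(* Let $k=2m+1>l=2h+1\ge 1$ be (odd) integers and $N>2k$. Then there exist $k$ positive constants $C_{k,l}^i$ ($i=1,\dots,k$) such that for all $u\in C_c^\infty(\mathbb{H}^N\setminus\{o\})$ $$\int_{\mathbb{H}^N}|\nabla_r(\Delta_r^m u)|^2\,dv_{\mathbb{H}^N}-\Big(\frac{N-1}{2}\Big)^{4(m-h)}\int_{\mathbb{H}^N}|\nabla_r(\Delta_r^h u)|^2\,dv_{\mathbb{H}^N}\ \ge\ \sum_{i=1}^{k}C_{k,l}^i\int_{\mathbb{H}^N}\frac{u^2}{r^{2i}}\,dv_{\mathbb{H}^N},$$ where $C_{k,l}^k=\frac14\,\Xi_{2,(k-1)/2}^{0}$ and $$C_{k,l}^1=\begin{cases}\dfrac14\,\Xi_{2,(k-1)/2}^{k-1}+\dfrac{(N-1)^2}{4}\,C_{k-1,l}^{1} & \text{if } m-h\ne 1,\\[2mm] \dfrac{(N-1)^3}{2^6}\,\Xi_{2,(l-1)/2}^{l-1}+\dfrac14\,\Xi_{2,(l+1)/2}^{l+1} & \text{if } m-h=1\ (\text{i.e. } k=2h+3,\ l=2h+1),\end{cases}$$ with the quantities $\Xi_{\alpha,\beta}^{0}$, $\Xi_{\alpha,\beta}^{2\beta}$ and (for $m-h\neq 1$) $C_{k-1,l}^{1}$ given by the explicit formulas in the context.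
   Context: $\mathbb{H}^N$ is the $N$-dimensional hyperbolic space with a fixed pole $o$. In geodesic polar coordinates $x=(r,\sigma)\in(0,\infty)\times\mathbb{S}^{N-1}$ about $o$, with $r$ the geodesic distance from $x$ to $o$, the metric is $dr^2+\sinh^2 r\,d\omega^2$ and $dv_{\mathbb{H}^N}=(\sinh r)^{N-1}\,dr\,d\sigma$ is the volume element. The radial gradient is $\nabla_r u=(\frac{\partial u}{\partial r},0)$, so $|\nabla_r u|^2=(\frac{\partial u}{\partial r})^2$; the radial Laplacian is $\Delta_r u=\frac{\partial^2u}{\partial r^2}+(N-1)\coth r\,\frac{\partial u}{\partial r}$, and $\Delta_r^j$ is its $j$-th iterate ($\Delta_r^0u=u$). The constants depend only on $N,k,l,i$, not on $u$. Explicit quantities. For $\alpha\ge0$ and an integer $\beta\ge1$: $$\Xi_{\alpha,\beta}^0=\prod_{j=0}^{\beta-1}\frac{(N+\alpha+4j)^2(N-\alpha-4j-4)^2}{16},\qquad \Xi_{\alpha,\beta}^{2\beta}=\Big(\frac{N-1}{4}\Big)^{2\beta},$$ and $\Xi_{\alpha,0}^0=1$. For $k=2m+1$, $l=2h+1$ with $m-h\ne1$ (so $k-1=2m$ is even, $l$ is odd, and $k-l-2=2(m-h)-2$ is a positive even integer): $$C_{k-1,l}^1=\frac{(N-1)^{2k-2l-3}}{2^{2k-2l}}\,\Xi_{2,(l-1)/2}^{l-1}+C_{k-l-2,0}^{1}\,\Xi_{2,(l+1)/2}^{l+1},$$ where for a positive even integer $n=2p$, $C_{n,0}^1=\frac{N(N-1)}{2^{4p}}\sum_{j=1}^{p}(N-1)^{4p-2j-2}$.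 *)

(* Defs.v *)
From HB Require Import structures.
From mathcomp Require Import all_boot all_order all_algebra.
From mathcomp Require Import all_classical all_reals all_analysis measurable_realfun.
Import Order.TTheory GRing.Theory Num.Theory numFieldNormedType.Exports.

Set Implicit Arguments.
Unset Strict Implicit.
Unset Printing Implicit Defensive.

Local Open Scope classical_set_scope.
Local Open Scope ring_scope.

(* Lebesgue measure on R^n and surface measure of the unit sphere.  Measure
   theory in R^n is done on [n.-tuple R], which carries the product
   sigma-algebra; topology and differentiation are done on ['rV[R]_n]. *)

Definition cons_tuple (R : realType) (n : nat) (p : R * n.-tuple R) :
  n.+1.-tuple R := [tuple of p.1 :: p.2].

Lemma measurable_cons_tuple (R : realType) n :
  measurable_fun [set: R * n.-tuple R] (@cons_tuple R n).
Proof. exact: measurable_cons. Qed.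

Section cons_measure.
Context {R : realType} {n : nat}.
Variable m : {sigma_finite_measure set (n.-tuple R) -> \bar R}.

Definition cons_measure : set (n.+1.-tuple R) -> \bar R :=
  pushforward (@lebesgue_measure R \x m)%E (@cons_tuple R n).

Let pf : {measure set (n.+1.-tuple R) -> \bar R} :=
  measure_function_pushforward__canonical__measure_function_Measure
    (@lebesgue_measure R \x m)%E (@measurable_cons_tuple R n).

Let cons_measure0 : cons_measure set0 = 0%E.
Proof. exact: (@measure0 _ _ _ pf). Qed.

Let cons_measure_ge0 A : (0 <= cons_measure A)%E.
Proof. exact: (@measure_ge0 _ _ _ pf). Qed.

Let cons_measure_sigma_additive : semi_sigma_additive cons_measure.
Proof. exact: (@measure_semi_sigma_additive _ _ _ pf). Qed.

HB.instance Definition _ := isMeasure.Build _ _ _ cons_measure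
  cons_measure0 cons_measure_ge0 cons_measure_sigma_additive.

Let uncons (t : n.+1.-tuple R) : R * n.-tuple R := (thead t, [tuple of behead t]).

Let consK : cancel (@cons_tuple R n) uncons.
Proof.
by move=> [x t]; rewrite /uncons /cons_tuple; congr pair; apply/val_inj.
Qed.

Let measurable_uncons : measurable_fun [set: n.+1.-tuple R] uncons.
Proof.
apply/measurable_fun_pairP; split => /=.
- exact: (@measurable_tnth _ R n.+1 ord0).
- exact: measurable_behead.
Qed.

Let cons_measure_sigma_finite : sigma_finite setT cons_measure.
Proof.
have /sigma_finiteP[F [TF ndF Foo]] := sigma_finiteT (@lebesgue_measure R).
have /sigma_finiteP[G [TG ndG Goo]] := sigma_finiteT m.
exists (fun k => uncons @^-1` (F k `*` G k)).
  apply/seteqP; split => // t _.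
  have [i _ Fi] : (\bigcup_k F k) (uncons t).1 by rewrite -TF.
  have [j _ Gj] : (\bigcup_k G k) (uncons t).2 by rewrite -TG.
  exists (maxn i j) => //; split.
  - by move: Fi; exact/subsetPset/ndF/leq_maxl.
  - by move: Gj; exact/subsetPset/ndG/leq_maxr.
move=> k; have [mF Fk] := Foo k; have [mG Gk] := Goo k; split.
  rewrite -[X in measurable X]setTI; apply: measurable_uncons => //.
  exact: measurableX.
rewrite /cons_measure /pushforward -comp_preimage (_ : uncons \o _ = id); last first.
  by apply/funext => p /=; rewrite consK.
by rewrite preimage_id product_measure1E// lte_mul_pinfty// ge0_fin_numE.
Qed.

HB.instance Definition _ := Measure_isSigmaFinite.Build _ _ _ cons_measure
  cons_measure_sigma_finite.

End cons_measure.

Fixpoint lebesgue_tuple (R : realType) (n : nat) :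
    {sigma_finite_measure set (n.-tuple R) -> \bar R} :=
  match n with
  | 0 => [the {sigma_finite_measure set (0.-tuple R) -> \bar R}
            of \d_([tuple] : 0.-tuple R)]
  | n'.+1 => [the {sigma_finite_measure set (n'.+1.-tuple R) -> \bar R}
               of cons_measure (lebesgue_tuple R n')]
  end.

Definition tuple_norm (R : realType) (N : nat) (t : N.-tuple R) : R :=
  Num.sqrt (\sum_(i < N) tnth t i ^+ 2).

Definition tuple_dir (R : realType) (N : nat) (t : N.-tuple R) : N.-tuple R :=
  [tuple tnth t i / tuple_norm t | i < N].

Definition unit_ball (R : realType) (N : nat) : set (N.-tuple R) :=
  [set t | 0 < tuple_norm t <= 1].
Arguments unit_ball : clear implicits.

Lemma measurable_tuple_norm (R : realType) N :
  measurable_fun [set: N.-tuple R] (@tuple_norm R N).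
Proof.
apply: (@measurableT_comp _ _ _ _ _ _ (@Num.sqrt R)).
  by apply: continuous_measurable_fun; exact: sqrt_continuous.
apply: measurable_sum => i; apply: measurable_funX.
exact: measurable_tnth.
Qed.

Lemma measurable_tuple_dir (R : realType) N :
  measurable_fun [set: N.-tuple R] (@tuple_dir R N).
Proof.
apply/measurable_fun_tnthP => i.
rewrite (_ : _ \o _ = fun t => tnth t i * tuple_norm t `^ (-1)); last first.
  by apply/funext => t /=; rewrite tnth_mktuple powR_inv1 ?sqrtr_ge0.
apply: measurable_funM; first exact: measurable_tnth.
apply: (@measurableT_comp _ _ _ _ _ _ (fun x : R => x `^ (-1))).
  exact: measurable_powR.
exact: measurable_tuple_norm.
Qed.

Lemma measurable_unit_ball (R : realType) N : measurable (unit_ball R N).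
Proof.
rewrite (_ : unit_ball R N = (@tuple_norm R N) @^-1` `]0, 1]%classic).
  rewrite -[X in measurable X]setTI; apply: measurable_tuple_norm => //.
by apply/seteqP; split => t /=; rewrite in_itv.
Qed.

Definition unit_cube (R : realType) (N : nat) : set (N.-tuple R) :=
  [set t | forall i, `|tnth t i| <= 1].
Arguments unit_cube : clear implicits.

Lemma measurable_cube (R : realType) N : measurable (unit_cube R N).
Proof.
rewrite (_ : unit_cube R N = \bigcap_(i in [set: 'I_N])
    ((fun t : N.-tuple R => tnth t i) @^-1` `[-1, 1]%classic)).
  apply: fin_bigcap_measurable => // i _; rewrite -[X in measurable X]setTI.
  exact: measurable_tnth.
apply/seteqP; split => t /= tP i.
  by move=> _ /=; rewrite in_itv /= -ler_norml.
by have /= := tP i I; rewrite in_itv /= -ler_norml.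
Qed.

Lemma lebesgue_tuple_cube (R : realType) N :
  (lebesgue_tuple R N (unit_cube R N) < +oo)%E.
Proof.
elim: N => [|N IH] /=.
  by rewrite diracE; case: (_ \in _); rewrite ltry.
rewrite /cons_measure /pushforward.
have -> : @cons_tuple R N @^-1` unit_cube R N.+1 =
    `[-1, 1]%classic `*` unit_cube R N.
  apply/seteqP; split => -[x t] /=.
    move=> xt; split=> [|i]; first by rewrite in_itv /= -ler_norml; exact: (xt ord0).
    by have := xt (lift ord0 i); rewrite tnthS.
  rewrite in_itv /= -ler_norml => -[x1 t1] i.
  by case: (unliftP ord0 i) => [j ->|->] //; rewrite tnthS.
rewrite product_measure1E//=.
  apply: lte_mul_pinfty => //; rewrite ge0_fin_numE ?measure_ge0//.
  by rewrite lebesgue_measure_itv /=; case: ifP => _; rewrite -?EFinD ltry.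
exact: measurable_cube.
Qed.

Lemma lebesgue_tuple_unit_ball (R : realType) N :
  (lebesgue_tuple R N (unit_ball R N) < +oo)%E.
Proof.
apply: le_lt_trans (lebesgue_tuple_cube R N); apply: le_measure.
- by rewrite inE; exact: measurable_unit_ball.
- by rewrite inE; exact: measurable_cube.
move=> t /= /andP[_ t1] i; rewrite -(@ler_pXn2r _ 2) ?nnegrE// expr1n.
rewrite -normrX ger0_norm ?sqr_ge0//.
have S0 : 0 <= \sum_(j < N) tnth t j ^+ 2 by apply: sumr_ge0 => j _; exact: sqr_ge0.
have : tuple_norm t ^+ 2 <= 1 by rewrite expr_le1// sqrtr_ge0.
rewrite sqr_sqrtr//; apply: le_trans.
by rewrite (bigD1 i)//= lerDl; apply: sumr_ge0 => j _; exact: sqr_ge0.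
Qed.

(* Cone formula for the surface measure of the unit sphere S^(N-1), seen as a
   measure on R^N carried by S^(N-1): sigma(A) is N times the volume of the cone
   { t | 0 < |t| <= 1, t/|t| \in A } over A. *)
Section sphere_measure.
Variables (R : realType) (N : nat).

Definition sphere_measure (A : set (N.-tuple R)) : \bar R :=
  (N%:R%:E * lebesgue_tuple R N (@tuple_dir R N @^-1` A `&` unit_ball R N))%E.

Let pf : {measure set (N.-tuple R) -> \bar R} :=
  mscale (N%:R%:nng)
    (measure_function_pushforward__canonical__measure_function_Measure
      (mrestr (lebesgue_tuple R N) (@measurable_unit_ball R N))
      (@measurable_tuple_dir R N)).

Let sphere_measure0 : sphere_measure set0 = 0%E.
Proof. exact: (@measure0 _ _ _ pf). Qed.

Let sphere_measure_ge0 A : (0 <= sphere_measure A)%E.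
Proof. exact: (@measure_ge0 _ _ _ pf). Qed.

Let sphere_measure_sigma_additive : semi_sigma_additive sphere_measure.
Proof. exact: (@measure_semi_sigma_additive _ _ _ pf). Qed.

HB.instance Definition _ := isMeasure.Build _ _ _ sphere_measure
  sphere_measure0 sphere_measure_ge0 sphere_measure_sigma_additive.

Let sphere_measure_finite : fin_num_fun sphere_measure.
Proof.
apply: lty_fin_num_fun; rewrite /sphere_measure.
apply: lte_mul_pinfty => //; apply: le_lt_trans (lebesgue_tuple_unit_ball R N).
apply: le_measure; rewrite ?inE; [|exact: measurable_unit_ball|exact: subIsetr].
apply: measurableI; last exact: measurable_unit_ball.
rewrite -[X in measurable X]setTI; exact: measurable_tuple_dir.
Qed.

HB.instance Definition _ := Measure_isFinite.Build _ _ _ sphere_measure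
  sphere_measure_finite.

End sphere_measure.
Arguments sphere_measure : clear implicits.

(* Hyperbolic space H^N with pole o is described in geodesic normal coordinates
   at o: the point at distance r from o in the direction of the unit vector s is
   r *: s in ['rV[R]_N], and o is 0.  So H^N is R^N with the metric
   dr^2 + (sinh r)^2 ds^2, and the differentiable structure of H^N \ {o} is that
   of R^N \ {0}. *)

Definition sinh (R : realType) (x : R) : R := (expR x - expR (- x)) / 2.

Definition cosh (R : realType) (x : R) : R := (expR x + expR (- x)) / 2.

Definition coth (R : realType) (x : R) : R := cosh x / sinh x.

Definition smooth (R : realType) (N : nat) (u : 'rV[R]_N -> R) : Prop :=
  forall s : seq 'I_N,
    let v := foldr (fun i f => 'D_(delta_mx 0 i) f) u s in
    continuous v /\ forall x i, derivable v x (delta_mx 0 i).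

(* C_c^oo(H^N \ {o}), its elements being extended by 0 at o. *)
Definition Cc_infty_punctured (R : realType) (N : nat) (u : 'rV[R]_N -> R) : Prop :=
  let supp := closure [set x | u x != 0] in
  [/\ smooth u, compact supp & ~ supp 0].

(* A function on H^N \ {o} in geodesic polar coordinates (r, s); only the values
   at r > 0 and |s| = 1 are meaningful. *)
Definition polar_fun (R : realType) (N : nat) := R -> N.-tuple R -> R.

Definition in_polar (R : realType) (N : nat) (u : 'rV[R]_N -> R) : polar_fun R N :=
  fun r s => u (r *: \row_i tnth s i).

Definition radial_deriv (R : realType) (N : nat) (f : polar_fun R N) : polar_fun R N :=
  fun r s => derive1 (f ^~ s) r.

Definition radial_laplacian (R : realType) (N : nat) (f : polar_fun R N) :
    polar_fun R N :=
  fun r s => radial_deriv (radial_deriv f) r s +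
    (N%:R - 1) * coth r * radial_deriv f r s.

Definition hyp_integral (R : realType) (N : nat) (f : polar_fun R N) : \bar R :=
  (\int[lebesgue_measure \x sphere_measure R N]_(p in [set p | 0 < p.1]%R)
    (f p.1 p.2 * sinh p.1 ^+ N.-1)%:E)%E.

(* Xi_zero is Xi_{alpha,beta}^0 and Xi_top is Xi_{alpha,beta}^{2 beta}, which
   does not depend on alpha. *)
Definition Xi_zero (R : realType) (N : nat) (alpha : R) (beta : nat) : R :=
  \prod_(j < beta)
    ((N%:R + alpha + 4 * j%:R) ^+ 2 * (N%:R - alpha - 4 * j%:R - 4) ^+ 2 / 16).

Definition Xi_top (R : realType) (N : nat) (alpha : R) (beta : nat) : R :=
  ((N%:R - 1) / 4) ^+ (2 * beta).

(* C_{n,0}^1 for n = 2p even and positive; the exponents are nonnegative. *)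
Definition C1_even_zero (R : realType) (N n : nat) : R :=
  let p := (n %/ 2)%N in
  N%:R * (N%:R - 1) / 2 ^+ (4 * p) *
    \sum_(1 <= j < p.+1) (N%:R - 1) ^+ (4 * p - 2 * j - 2).

(* C_{k-1,l}^1 as a function of k and l, for k and l odd with k - l > 2. *)
Definition C1_pred_odd (R : realType) (N k l : nat) : R :=
  (N%:R - 1) ^+ (2 * k - 2 * l - 3) / 2 ^+ (2 * k - 2 * l) *
    Xi_top N 2 ((l - 1) %/ 2) +
  C1_even_zero R N (k - l - 2) * Xi_top N 2 ((l + 1) %/ 2).

(* Main.v *)
Require Import Defs.
From mathcomp Require Import all_boot all_order all_algebra ring lra zify.
From mathcomp Require Import all_classical all_reals all_analysis.
From mathcomp Require Import measurable_realfun.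
Import Order.TTheory GRing.Theory Num.Theory numFieldNormedType.Exports.

(** Write n = N - 1 and w(r) = (sinh r)^n.  In geodesic polar coordinates every
    integral of the statement is the integral over the unit sphere of integrals
    over the rays r > 0 with density w, and only radial derivatives occur.  So it
    is enough to prove the inequality on each ray, with constants that do not
    depend on the ray, for the functions v_j(r) = (Delta_r^j u)(r, s), which are
    smooth with compact support in (0, oo).

    On a ray the only integral identity that is used is that the derivative of a
    compactly supported function has integral 0.  Applied to p^2 t r^(-a) w, with
    t = A coth r + B / r + C for suitable constants A, B, C, it completes a square
    ([ile_weight]) and leaves a potential in front of p^2, which is bounded below
    with coth r >= 1, coth r >= 1/r and coth^2 r >= 1/r^2 + 1/2.  For p = v this
    gives a Poincare inequality ([ile_poincare]), a Hardy inequality ([ile_hardy])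
    and the Poincare inequality with Hardy remainder ([ile_poincare_hardy])
      int v'^2 w >= (n/2)^2 int v^2 w + 1/4 int v^2/r^2 w;
    for p = v' it bounds below the integral of (Delta_r v)^2 = (p' + n coth r p)^2
    ([ile_radial_div0], [ile_radial_div]).

    Combining the two kinds of estimates gives the weighted Rellich inequality
    [ile_rellich]: the integral of (Delta_r v)^2 / r^a dominates that of v^2 against
      ((N+a)^2 (N-a-4)^2 / 16) / r^(a+4) + c' / r^(a+2) + c / r^a   with c, c' > 0.
    The first coefficient is the first factor of Xi_zero; for a = 2 the last one is
    strictly larger than (n/4)^2, the factor of Xi_top.  Iterating the inequality,
    with a replaced by a + 4 along the leading term and with a = 2 along the last
    one, yields [ile_Xi], a lower bound of int (Delta_r^m u)^2 / r^2 w in which both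
    Xi_zero and Xi_top appear, with some strict excess.

    Finally int |(Delta_r^m u)'|^2 w >= (n/2)^2 int (Delta_r^m u)^2 w
    + 1/4 int (Delta_r^m u)^2 / r^2 w.  The last term is bounded by [ile_Xi]; it
    gives C_k and a part of C_1.  The other one is brought down to
    int |(Delta_r^h u)'|^2 w by [ile_lap_iter_grad], which produces multiples of
    int u^2 / r^2 w and so the rest of C_1.  The excess in [ile_Xi], of the form
    e (1/r^2 + 1/r^(2k-2)), pays for the positive constants C_i with 1 < i < k.

    To return from rays to the hyperbolic space one needs that iterated radial
    Laplacians of u are differentiable along rays, jointly measurable, and bounded
    on the support of u; all three follow by induction from the fact that they are
    polynomials in coth r, the coordinates of s and the partial derivatives of u at
    r s ([polar_poly]). *)

Set Implicit Arguments.
Unset Strict Implicit.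
Unset Printing Implicit Defensive.

Local Open Scope classical_set_scope.
Local Open Scope ring_scope.

(** * Derivatives on the real line and hyperbolic functions *)

Section derivation_rules.
Context {R : realType}.
Implicit Types (f g : R -> R) (x a b : R).

(** A constant with pointwise rules below, so that derivatives of explicit
    expressions are computed by syntax-directed application of lemmas on
    functions of the form [fun t => f t * g t]. *)
Definition has_deriv f x a := is_derive x (1 : R) f a.

Lemma has_deriv_eq f x a b : has_deriv f x a -> a = b -> has_deriv f x b.
Proof. by move=> ? <-. Qed.

Lemma has_deriv_cst x (c : R) : has_deriv (fun=> c) x 0.
Proof. exact: is_derive_cst. Qed.

Lemma has_deriv_id x : has_deriv (fun t => t) x 1.
Proof. exact: is_derive_id. Qed.

Lemma has_derivD f g x a b : has_deriv f x a -> has_deriv g x b ->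
  has_deriv (fun t => f t + g t) x (a + b).
Proof. by rewrite /has_deriv => ? ?; exact: is_deriveD. Qed.

Lemma has_derivN f x a : has_deriv f x a -> has_deriv (fun t => - f t) x (- a).
Proof. by rewrite /has_deriv => ?; exact: is_deriveN. Qed.

Lemma has_derivM f g x a b : has_deriv f x a -> has_deriv g x b ->
  has_deriv (fun t => f t * g t) x (a * g x + f x * b).
Proof.
rewrite /has_deriv => fa gb; have := is_deriveM fa gb.
by rewrite /GRing.scale/= addrC (mulrC a).
Qed.

Lemma has_derivV f x a : f x != 0 -> has_deriv f x a ->
  has_deriv (fun t => (f t)^-1) x (- a / f x ^+ 2).
Proof.
rewrite /has_deriv => f0 fa; have := is_deriveV f0 fa.
by rewrite /GRing.scale/= !mulNr mulrC.
Qed.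

Lemma has_derivX f x a n : has_deriv f x a ->
  has_deriv (fun t => f t ^+ n) x (n%:R * f x ^+ n.-1 * a).
Proof. by rewrite /has_deriv => fa; have := is_deriveX n fa; rewrite exprfctE. Qed.

Lemma has_deriv_val f x a : has_deriv f x a -> derive1 f x = a.
Proof. by move=> [_ <-]; rewrite derive1E. Qed.

Lemma has_deriv_derivable f x a : has_deriv f x a -> derivable f x (1 : R).
Proof. by case. Qed.

Lemma derivable_has_deriv f x : derivable f x (1 : R) ->
  has_deriv f x (derive1 f x).
Proof. by move=> ?; rewrite derive1E; exact/derivableP. Qed.

Lemma has_deriv_continuous f x a : has_deriv f x a -> {for x, continuous f}.
Proof. by move=> [/derivable1_diffP/differentiable_continuous]. Qed.

Lemma has_deriv_near f g x a : (\near x, f x = g x) ->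
  has_deriv f x a -> has_deriv g x a.
Proof. exact: near_eq_is_derive. Qed.

Lemma deriv_ge0_le (f df : R -> R) (x : R) : 0 <= x ->
  (forall t, has_deriv f t (df t)) -> (forall t, 0 <= t -> 0 <= df t) ->
  f 0 <= f x.
Proof.
move=> x0 fd fp.
have cf : {within `[0, x], continuous f}.
  by apply: derivable_within_continuous => t _; have [] := fd t.
have [c] := MVT_segment x0 (fun t _ => fd t) cf.
rewrite in_itv/= => /andP[c0 cx] /eqP; rewrite subr0 subr_eq => /eqP ->.
by rewrite lerDr; apply: mulr_ge0 => //; exact: fp.
Qed.

End derivation_rules.

Section hyperbolic.
Context {R : realType}.
Implicit Types x y r : R.

Lemma has_deriv_expRN x : has_deriv (fun t => expR (- t)) x (- expR (- x)).
Proof.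
rewrite -mulN1r mulrC.
exact: (@is_derive1_comp R expR -%R).
Qed.

Lemma has_deriv_sinh x : has_deriv (@sinh R) x (cosh x).
Proof.
apply: has_deriv_eq.
  apply: has_derivM; last exact: has_deriv_cst.
  apply: has_derivD; first exact: is_derive_expR.
  by apply: has_derivN; exact: has_deriv_expRN.
by rewrite /cosh; field.
Qed.

Lemma has_deriv_cosh x : has_deriv (@cosh R) x (sinh x).
Proof.
apply: has_deriv_eq.
  apply: has_derivM; last exact: has_deriv_cst.
  apply: has_derivD; first exact: is_derive_expR.
  exact: has_deriv_expRN.
by rewrite /sinh; field.
Qed.

Lemma cosh2Bsinh2 x : cosh x ^+ 2 - sinh x ^+ 2 = 1.
Proof.
have e : expR x * expR (- x) = 1 by rewrite expRN divff// gt_eqF// expR_gt0.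
rewrite /cosh /sinh; nra.
Qed.

Lemma cosh_gt0 x : 0 < cosh x.
Proof. by rewrite /cosh divr_gt0// addr_gt0// expR_gt0. Qed.

Lemma sinh0 : sinh 0 = 0 :> R.
Proof. by rewrite /sinh oppr0 subrr mul0r. Qed.

Lemma sinh_gt0 x : 0 < x -> 0 < sinh x.
Proof. by move=> x0; rewrite /sinh divr_gt0// subr_gt0 ltr_expR; lra. Qed.

Lemma sinh_ge0 x : 0 <= x -> 0 <= sinh x.
Proof. by rewrite le_eqVlt => /predU1P[<-|/sinh_gt0/ltW//]; rewrite sinh0. Qed.

Lemma sinhDD x : sinh (x + x) = 2 * (sinh x * cosh x).
Proof. by rewrite /sinh /cosh opprD !expRD; field. Qed.

Lemma sinh_le_Mcosh x : 0 <= x -> sinh x <= x * cosh x.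
Proof.
move=> x0; rewrite -subr_ge0.
have := @deriv_ge0_le _ (fun t => t * cosh t - sinh t) (fun t => t * sinh t) x x0.
rewrite mul0r sinh0 subrr; apply => [t|t t0].
  apply: has_deriv_eq.
    apply: has_derivD.
      by apply: has_derivM; [exact: has_deriv_id|exact: has_deriv_cosh].
    by apply: has_derivN; exact: has_deriv_sinh.
  by rewrite /=; ring.
by rewrite mulr_ge0 // sinh_ge0.
Qed.

(** With y = r/2, the inequality tanh y <= y gives sinh r (1 - y^2) <= r, and
    (1 - y^2)^2 >= 1 - 2 y^2. *)
Lemma sinh2_bound r : 0 < r -> sinh r ^+ 2 * (1 - r ^+ 2 / 2) <= r ^+ 2.
Proof.
move=> r0; pose y := r / 2; have y0 : 0 < y by rewrite divr_gt0.
have -> : r = y + y by rewrite /y; field.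
rewrite sinhDD.
have SyC := sinh_le_Mcosh (ltW y0).
have S0 := sinh_gt0 y0; have C0 := cosh_gt0 y; have := cosh2Bsinh2 y.
move: SyC S0 C0; set S := sinh y; set C := cosh y => SyC S0 C0 CS.
have S2 : S ^+ 2 <= y ^+ 2 * C ^+ 2.
  by rewrite -exprMn ler_pXn2r// nnegrE ?ltW// mulr_gt0.
have C2E : C ^+ 2 = 1 + S ^+ 2 by rewrite -CS; ring.
have [y1|y1] := lerP (y ^+ 2) 1; last first.
  apply: (@le_trans _ _ 0); last exact: sqr_ge0.
  by rewrite mulr_ge0_le0 ?sqr_ge0//; lra.
have A1 : S ^+ 2 * (1 - y ^+ 2) <= y ^+ 2 by rewrite C2E in S2; lra.
have A2 : C ^+ 2 * (1 - y ^+ 2) <= 1 by rewrite C2E; lra.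
have A3 : (S ^+ 2 * (1 - y ^+ 2)) * (C ^+ 2 * (1 - y ^+ 2)) <= y ^+ 2 * 1.
  by apply: ler_pM => //; rewrite mulr_ge0 ?sqr_ge0// subr_ge0.
have A4 : (S * C) ^+ 2 * (1 - y ^+ 2 *+ 2) <= (S * C) ^+ 2 * (1 - y ^+ 2) ^+ 2.
  by rewrite ler_wpM2l ?sqr_ge0//; have := sqr_ge0 (y ^+ 2); lra.
lra.
Qed.

Lemma sinh_le_cosh x : sinh x <= cosh x.
Proof. by rewrite /sinh /cosh; have := expR_gt0 (- x); lra. Qed.

Lemma coth_ge1 r : 0 < r -> 1 <= coth r.
Proof.
by move=> /sinh_gt0 r0; rewrite /coth ler_pdivlMr// mul1r sinh_le_cosh.
Qed.

Lemma coth_ge_inv r : 0 < r -> r^-1 <= coth r.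
Proof.
move=> r0; have s0 := sinh_gt0 r0.
rewrite /coth ler_pdivlMr// ler_pdivrMl//; exact: sinh_le_Mcosh (ltW r0).
Qed.

Lemma coth2 r : 0 < r -> coth r ^+ 2 = 1 + (sinh r)^-2.
Proof.
move=> /sinh_gt0 s0; rewrite /coth; have := cosh2Bsinh2 r.
move/(canRL (subrK _)) => E; rewrite exprMn E; field; exact: lt0r_neq0.
Qed.

(** The coefficient 1 of 1/r^2 cannot be increased, and the sharp constants
    Xi_zero depend on it.  The additive constant could be as large as 2/3; any
    value that leaves a positive potential at infinity in [ile_radial_div]
    and enough of it to reach Xi_top would do. *)
Lemma coth2_ge r : 0 < r -> (r ^- 2) + 1 / 2 <= coth r ^+ 2.
Proof.
move=> r0; rewrite coth2//.
have s0 := sinh_gt0 r0; have := sinh2_bound r0; set s := sinh r => H.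
rewrite -subr_ge0 (_ : _ - _ = (r ^+ 2 - s ^+ 2 * (1 - r ^+ 2 / 2)) / (s ^+ 2 * r ^+ 2)).
  by rewrite divr_ge0 ?subr_ge0// mulr_ge0// sqr_ge0.
by field; rewrite !lt0r_neq0.
Qed.

Lemma has_deriv_coth r : 0 < r -> has_deriv (@coth R) r (1 - coth r ^+ 2).
Proof.
move=> r0; have s0 := sinh_gt0 r0.
apply: has_deriv_eq.
  apply: has_derivM; first exact: has_deriv_cosh.
  by apply: has_derivV; [exact: lt0r_neq0|exact: has_deriv_sinh].
by rewrite /coth; field; rewrite lt0r_neq0.
Qed.

End hyperbolic.

(** * Comparison of integrals up to a compactly supported derivative *)

Section comparison.
Context {R : realType}.
Implicit Types (f g p v : R -> R) (r : R).

Definition supported_in (a b : R) f :=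
  forall r, 0 < r -> (r < a) || (b < r) -> f r = 0.

(** C^1 functions with compact support in the open half-line.  Values at r <= 0 are
    left free, because a function in polar coordinates is only meaningful at
    r > 0. *)
Definition C1c f :=
  [/\ exists a b, 0 < a /\ a < b /\ supported_in a b f,
      forall r, 0 < r -> derivable f r 1
    & forall r, 0 < r -> {for r, continuous (derive1 f)}].

(** The inequality between the integrals of [f] and [g] over (0, oo), in a form
    that can be manipulated without integrability hypotheses: [f] is below [g]
    up to the derivative of a compactly supported function.  It is transitive
    and compatible with sums and nonnegative scaling, and [ile_integral] turns
    it into an inequality of integrals. *)
Definition ile f g := exists Phi,
  C1c Phi /\ forall r, 0 < r -> f r + derive1 Phi r <= g r.

Lemma continuous_near f g r : (\near r, f r = g r) ->
  {for r, continuous f} -> {for r, continuous g}.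
Proof.
move=> fg; rewrite /prop_for /continuous_at (nbhs_singleton fg) => cf.
by apply: cvg_trans cf; apply: near_eq_cvg; apply: filterS fg => t.
Qed.

Lemma near_pos r (P : R -> Prop) : 0 < r -> (forall t, 0 < t -> P t) ->
  \near r, P r.
Proof.
by move=> r0 H; apply: filterS (lt_nbhsr r0) => t; exact: H.
Qed.

(** The derivative may be given by a formula that is valid on the half-line only. *)
Lemma C1c_of f df : (exists a b, 0 < a /\ a < b /\ supported_in a b f) ->
  (forall r, 0 < r -> has_deriv f r (df r)) ->
  (forall r, 0 < r -> {for r, continuous df}) -> C1c f.
Proof.
move=> sf fd cd; split=> // r r0; first by have [] := fd r r0.
apply: (@continuous_near df); last exact: cd.
by apply: near_pos => // t t0; rewrite (has_deriv_val (fd t t0)).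
Qed.

Lemma C1c_deriv f r : C1c f -> 0 < r -> has_deriv f r (derive1 f r).
Proof. by move=> [_ fd _] r0; apply: derivable_has_deriv; exact: fd. Qed.

Lemma C1c_cont f r : C1c f -> 0 < r -> {for r, continuous f}.
Proof. by move=> fC r0; exact: has_deriv_continuous (C1c_deriv fC r0). Qed.

Lemma C1c0 : C1c (fun=> 0).
Proof.
apply: (@C1c_of _ (fun=> 0)).
- by exists 1, 2; split=> //; split=> //; rewrite ltr1n.
- by move=> r _; exact: has_deriv_cst.
- by move=> r _; exact: cst_continuous.
Qed.

Lemma C1cD f g : C1c f -> C1c g -> C1c (fun r => f r + g r).
Proof.
move=> fC gC; have [[a [b [a0 [ab sf]]]] _ cf] := fC.
have [[c [d [c0 [cd sg]]]] _ cg] := gC.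
apply: (@C1c_of _ (fun r => derive1 f r + derive1 g r)).
- exists (Num.min a c), (Num.max b d); split; first by rewrite lt_min a0.
  split; first by rewrite gt_min lt_max ab.
  move=> r r0 /orP[].
    by rewrite lt_min => /andP[ra rc]; rewrite sf ?sg ?ra ?rc ?addr0.
  by rewrite gt_max => /andP[ra rc]; rewrite sf ?sg ?ra ?rc ?addr0 ?orbT.
- by move=> r r0; apply: has_derivD; exact: C1c_deriv.
- by move=> r r0; apply: continuousD; [exact: cf|exact: cg].
Qed.

Lemma C1cZ (c : R) f : C1c f -> C1c (fun r => c * f r).
Proof.
move=> fC; have [[a [b [a0 [ab sf]]]] _ cf] := fC.
apply: (@C1c_of _ (fun r => c * derive1 f r)).
- by exists a, b; split=> //; split=> // r r0 rab; rewrite sf // mulr0.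
- move=> r r0; apply: has_deriv_eq.
    by apply: has_derivM; [exact: has_deriv_cst|exact: C1c_deriv].
  by rewrite mul0r add0r.
- by move=> r r0; apply: continuousM; [exact: cst_continuous|exact: cf].
Qed.

Lemma ile_le f g : (forall r, 0 < r -> f r <= g r) -> ile f g.
Proof.
move=> fg; exists (fun=> 0); split; first exact: C1c0.
by move=> r r0; rewrite (has_deriv_val (has_deriv_cst r 0)) addr0; exact: fg.
Qed.

Lemma ileD f g f' g' : ile f g -> ile f' g' ->
  ile (fun r => f r + f' r) (fun r => g r + g' r).
Proof.
move=> [F [FC FP]] [G [GC GP]]; exists (fun r => F r + G r); split.
  exact: C1cD.
move=> r r0; rewrite (has_deriv_val (has_derivD (C1c_deriv FC r0) (C1c_deriv GC r0))).
by rewrite addrACA lerD ?FP ?GP.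
Qed.

Lemma ileZ c f g : 0 <= c -> ile f g -> ile (fun r => c * f r) (fun r => c * g r).
Proof.
move=> c0 [F [FC FP]]; exists (fun r => c * F r); split; first exact: C1cZ.
move=> r r0.
rewrite (has_deriv_val (has_derivM (has_deriv_cst _ _) (C1c_deriv FC r0))).
by rewrite mul0r add0r -mulrDr ler_wpM2l// FP.
Qed.

Lemma ile_trans g f h : ile f g -> ile g h -> ile f h.
Proof.
move=> [F [FC FP]] [G [GC GP]]; exists (fun r => F r + G r); split.
  exact: C1cD.
move=> r r0; rewrite (has_deriv_val (has_derivD (C1c_deriv FC r0) (C1c_deriv GC r0))).
rewrite addrA; apply: le_trans (GP r r0); rewrite lerD2r; exact: FP.
Qed.

Lemma ile_eql f f' g : (forall r, 0 < r -> f r = f' r) -> ile f' g -> ile f g.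
Proof. by move=> ff'; apply: ile_trans; apply: ile_le => r /ff' ->. Qed.

(** The comparison function is p^2 psi, which inherits its support from p. *)
Lemma ile_sqr p psi dpsi f g : C1c p ->
  (forall r, 0 < r -> has_deriv psi r (dpsi r)) ->
  (forall r, 0 < r -> {for r, continuous dpsi}) ->
  (forall r, 0 < r ->
    f r + (2 * p r * derive1 p r * psi r + p r ^+ 2 * dpsi r) <= g r) ->
  ile f g.
Proof.
move=> pC psid psic fg; have [[a [b [a0 [ab sp]]]] _ cp] := pC.
pose dPhi r := 2 * p r * derive1 p r * psi r + p r ^+ 2 * dpsi r.
have dP r : 0 < r -> has_deriv (fun r => p r ^+ 2 * psi r) r (dPhi r).
  move=> r0; apply: has_deriv_eq.
    by apply: has_derivM; [apply: has_derivX; exact: C1c_deriv|exact: psid].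
  by rewrite /dPhi /=; ring.
exists (fun r => p r ^+ 2 * psi r); split; last first.
  by move=> r r0; rewrite (has_deriv_val (dP r r0)); exact: fg.
apply: (@C1c_of _ dPhi) => //.
  by exists a, b; split=> //; split=> // r r0 rab; rewrite sp// expr0n mul0r.
move=> r r0; have cpr := C1c_cont pC r0.
have cpsi := has_deriv_continuous (psid r r0).
apply: (@continuousD _ _ _ (fun r => 2 * p r * derive1 p r * psi r)).
  apply: (@continuousM _ _ (fun r => 2 * p r * derive1 p r)) => //.
  apply: (@continuousM _ _ (fun r => 2 * p r)) => //; last exact: cp.
  by apply: continuousM => //; exact: cst_continuous.
apply: (@continuousM _ _ (fun r => p r ^+ 2)) => //; last exact: psic.
exact: (@continuousM _ _ p p).
Qed.

End comparison.

Section weights.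
Context {R : realType}.
Variable n : nat.
Implicit Types (f g p v : R -> R) (r : R).

Definition weight (al : nat) r : R := sinh r ^+ n / r ^+ al.

Lemma weight_ge0 al r : 0 < r -> 0 <= weight al r.
Proof.
by move=> r0; rewrite /weight mulr_ge0// ?invr_ge0 exprn_ge0// ?ltW// sinh_gt0.
Qed.

Lemma weightD al be r : weight (al + be) r = r ^- be * weight al r.
Proof. by rewrite /weight exprD invfM mulrA mulrC. Qed.

Lemma has_deriv_weight al r : 0 < r ->
  has_deriv (weight al) r (weight al r * (n%:R * coth r - al%:R / r)).
Proof.
move=> r0; have s0 := sinh_gt0 r0; rewrite /weight; apply: has_deriv_eq.
  apply: has_derivM; first by apply: has_derivX; exact: has_deriv_sinh.
  apply: has_derivV; first by rewrite expf_eq0 negb_and orbC lt0r_neq0.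
  by apply: has_derivX; exact: has_deriv_id.
rewrite /coth /=.
have e1 : n%:R * sinh r ^+ n.-1 * sinh r = n%:R * sinh r ^+ n :> R.
  by case: (n) => [|k]; rewrite ?mul0r // -mulrA -exprSr.
have e2 : al%:R * r ^+ al.-1 * r = al%:R * r ^+ al.
  by case: (al) => [|k]; rewrite ?mul0r // -mulrA -exprSr.
have sn := lt0r_neq0 s0; have rn := lt0r_neq0 r0.
have ra : r ^+ al != 0 by rewrite expf_neq0.
move: e1 e2; set a := _ ^+ n.-1; set b := _ ^+ al.-1 => /(canRL (mulfK sn)) e1.
move=> /(canRL (mulfK rn)) e2; rewrite e1 mulr1 e2.
by field; rewrite ra sn rn.
Qed.

Lemma weight_cont al r : 0 < r -> {for r, continuous (weight al)}.
Proof. by move=> r0; exact: has_deriv_continuous (has_deriv_weight al r0). Qed.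

Lemma coth_cont r : 0 < r -> {for r, continuous (@coth R)}.
Proof. by move=> r0; exact: has_deriv_continuous (has_deriv_coth r0). Qed.

(** All the multipliers needed below are the product of the weight with a
    combination of coth r, 1/r and 1, which differentiates into a polynomial in
    these functions.  So each inequality on a ray reduces to a polynomial
    inequality in p, p', coth r and 1/r. *)
Lemma ile_weight al (A B C : R) p f g : C1c p ->
  (forall r, 0 < r ->
    let c := coth r in let i := r^-1 in let t := A * c + B * i + C in
    f r + (2 * p r * derive1 p r * t +
      p r ^+ 2 * (A * (1 - c ^+ 2) - B * i ^+ 2
        + t * (n%:R * c - al%:R * i))) * weight al r <= g r) ->
  ile f g.
Proof.
move=> pC H.
pose tau r := A * coth r + B * r^-1 + C.
pose dtau r := A * (1 - coth r ^+ 2) - B * r^-1 ^+ 2.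
pose dw r := weight al r * (n%:R * coth r - al%:R / r).
have dt r : 0 < r -> has_deriv tau r (dtau r).
  move=> r0; apply: has_deriv_eq.
    apply: has_derivD; last exact: has_deriv_cst.
    apply: has_derivD.
      by apply: has_derivM; [exact: has_deriv_cst|exact: has_deriv_coth].
    apply: has_derivM; first exact: has_deriv_cst.
    by apply: has_derivV; [rewrite lt0r_neq0|exact: has_deriv_id].
  by rewrite /dtau; field; rewrite lt0r_neq0.
have cinv r : 0 < r -> {for r, continuous (fun r : R => r^-1)}.
  by move=> r0; apply: inv_continuous; rewrite lt0r_neq0.
apply: (@ile_sqr _ p (fun r => tau r * weight al r)
  (fun r => dtau r * weight al r + tau r * dw r)) => //.
- by move=> r r0; apply: has_derivM; [exact: dt|exact: has_deriv_weight].
- move=> r r0; have cc := coth_cont r0; have ci := cinv _ r0.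
  have cw : {for r, continuous (weight al)} by exact: weight_cont.
  apply: (@continuousD _ _ _ (fun r => dtau r * weight al r)).
    apply: (@continuousM _ _ dtau) => //.
    apply: (@continuousB _ _ _ (fun r => A * (1 - coth r ^+ 2))).
      apply: (@continuousM _ _ (fun=> A)); first exact: cst_continuous.
      apply: (@continuousB R R R (fun=> 1 : R)); first exact: cst_continuous.
      exact: (@continuousM _ _ (@coth R) (@coth R)).
    apply: (@continuousM _ _ (fun=> B)); first exact: cst_continuous.
    exact: (@continuousM _ _ (fun r : R => r^-1) (fun r : R => r^-1)).
  apply: (@continuousM _ _ tau).
    exact: has_deriv_continuous (dt _ r0).
  apply: (@continuousM _ _ (weight al)) => //.
  apply: (@continuousB _ _ _ (fun r => n%:R * coth r)).
    by apply: (@continuousM _ _ (fun=> n%:R)) => //; exact: cst_continuous.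
  by apply: (@continuousM _ _ (fun=> al%:R)) => //; exact: cst_continuous.
move=> r r0; apply: le_trans (H r r0); rewrite lerD2l /= le_eqVlt; apply/orP; left.
by apply/eqP; rewrite /dtau /tau /dw; ring.
Qed.

End weights.

(** * Weighted Poincare and Hardy inequalities on a ray *)

Section first_order.
Context {R : realType}.
Variable n : nat.
Implicit Types (f g p v : R -> R) (r : R).

Definition wsq al f r : R := f r ^+ 2 * weight n al r.

(** The radial Laplacian of v is [radial_div] of v': it is the divergence of the
    radial field with component p. *)
Definition radial_div p r : R := derive1 p r + n%:R * coth r * p r.

Lemma wsqS2 al f r : wsq al.+2 f r = r^-1 ^+ 2 * (wsq al f r).
Proof. by rewrite /wsq -(addn2 al) weightD exprVn mulrCA. Qed.

(** Constant multiplier: the logarithmic derivative n coth r - al / r of the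
    weight is at least n - al. *)
Lemma ile_poincare al v : (al <= n)%N -> C1c v ->
  ile (fun r => ((n%:R - al%:R) / 2) ^+ 2 * wsq al v r) (wsq al (derive1 v)).
Proof.
move=> aln vC; apply: (@ile_weight _ n al 0 0 (- ((n%:R - al%:R) / 2)) v) => // r r0 /=.
rewrite /wsq; have := weight_ge0 n al r0.
have := coth_ge1 r0; have := coth_ge_inv r0.
have a0 : 0 <= al%:R :> R by [].
have d0 : 0 <= n%:R - al%:R :> R by rewrite subr_ge0 ler_nat.
move: a0 d0; set a : R := al%:R; set b : R := n%:R.
set w := weight _ _ r; set c := coth r; set i := r^-1; set x := v r; set y := derive1 v r.
move=> a0 d0 ci c1 w0; rewrite -subr_ge0.
rewrite (_ : _ - _ = ((y + (b - a) / 2 * x) ^+ 2 +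
  x ^+ 2 * ((b - a) / 2 * ((b - a) * (c - 1) + a * (c - i)))) * w); last by field.
rewrite mulr_ge0//.
rewrite addr_ge0 ?sqr_ge0// mulr_ge0 ?sqr_ge0// mulr_ge0 ?divr_ge0//.
by rewrite addr_ge0// mulr_ge0// subr_ge0.
Qed.

(** Multiplier in 1/r: n coth r - al / r is at least (n - al) / r. *)
Lemma ile_hardy al v : (al < n)%N -> C1c v ->
  ile (fun r => ((n%:R - al%:R - 1) / 2) ^+ 2 * wsq al.+2 v r)
      (wsq al (derive1 v)).
Proof.
move=> aln vC.
apply: (@ile_weight _ n al 0 (- ((n%:R - al%:R - 1) / 2)) 0 v) => // r r0 /=.
rewrite wsqS2 /wsq; have := weight_ge0 n al r0.
have := coth_ge_inv r0.
have b0 : 0 <= n%:R :> R by [].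
have d0 : 0 <= n%:R - al%:R - 1 :> R.
  by rewrite -addrA -opprD natr1 subr_ge0 ler_nat.
have i0 : 0 <= r^-1 by rewrite invr_ge0 ltW.
move: b0 d0 i0; set a : R := al%:R; set b : R := n%:R.
set w := weight _ _ r; set c := coth r; set i := r^-1; set x := v r; set y := derive1 v r.
move=> a0 d0 i0 ci w0; rewrite -subr_ge0.
rewrite (_ : _ - _ = ((y + (b - a - 1) / 2 * i * x) ^+ 2 +
  x ^+ 2 * ((b - a - 1) / 2 * i * (b * (c - i)))) * w); last by field.
rewrite mulr_ge0//.
rewrite addr_ge0 ?sqr_ge0// mulr_ge0 ?sqr_ge0// mulr_ge0//.
  by rewrite mulr_ge0 ?divr_ge0.
by rewrite mulr_ge0 ?subr_ge0.
Qed.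

(** The substitution v = w^(-1/2) z followed by the one-dimensional Hardy
    inequality for z amounts to the multiplier -(n coth r - 1/r) / 2.  The
    potential that remains is n (n - 2) / (4 sinh^2 r), which is dropped. *)
Lemma ile_poincare_hardy v : (1 < n)%N -> C1c v ->
  ile (fun r => (n%:R / 2) ^+ 2 * wsq 0 v r + 1 / 4 * wsq 2 v r)
      (wsq 0 (derive1 v)).
Proof.
move=> n1 vC; apply: (@ile_weight _ n 0 (- (n%:R / 2)) (1 / 2) 0 v) => // r r0 /=.
rewrite wsqS2 /wsq; have := weight_ge0 n 0 r0.
have := coth_ge1 r0.
have b0 : 0 <= n%:R - 2 :> R by rewrite subr_ge0 ler_nat.
move: b0; set b : R := n%:R.
set w := weight _ _ r; set c := coth r; set i := r^-1; set x := v r; set y := derive1 v r.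
move=> b0 ci w0; rewrite -subr_ge0.
rewrite (_ : _ - _ = ((y + (b / 2 * c - i / 2) * x) ^+ 2 +
  x ^+ 2 * (b / 4 * (b - 2) * (c ^+ 2 - 1))) * w); last by field.
rewrite mulr_ge0//.
rewrite addr_ge0 ?sqr_ge0// mulr_ge0 ?sqr_ge0// mulr_ge0//.
  by apply: mulr_ge0 => //; lra.
by rewrite subr_ge0 exprn_ege1.
Qed.

(** Expanding the square and integrating the cross term by parts, the integral of
    (p' + n coth r p)^2 w is that of (p'^2 + n p^2 / sinh^2 r) w; the first
    part is then treated as in [ile_poincare_hardy].  The multiplier is the sum of
    those of the two steps. *)
Lemma ile_radial_div0 p : C1c p ->
  ile (fun r => (n%:R / 2) ^+ 2 * wsq 0 p r + 1 / 4 * wsq 2 p r)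
      (wsq 0 (radial_div p)).
Proof.
move=> pC; apply: (@ile_weight _ n 0 (n%:R / 2) (1 / 2) 0 p) => // r r0 /=.
rewrite wsqS2 /wsq; have := weight_ge0 n 0 r0.
have := coth_ge1 r0.
have b0 : 0 <= n%:R :> R by [].
rewrite /radial_div; move: b0; set b : R := n%:R.
set w := weight _ _ r; set c := coth r; set i := r^-1; set x := p r; set y := derive1 p r.
move=> b0 ci w0; rewrite -subr_ge0.
rewrite (_ : _ - _ = ((y + (b / 2 * c - i / 2) * x) ^+ 2 +
  x ^+ 2 * (b / 4 * (b + 2) * (c ^+ 2 - 1))) * w); last by field.
rewrite mulr_ge0//.
rewrite addr_ge0 ?sqr_ge0// mulr_ge0 ?sqr_ge0// mulr_ge0//.
  by apply: mulr_ge0 => //; lra.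
by rewrite subr_ge0 exprn_ege1.
Qed.

(** The weighted version of [ile_radial_div0].  The potential is
    n^2/4 + (n^2/4 + n/2) / sinh^2 r + (al+1)^2 / (4 r^2) + n al coth r / (2 r);
    near r = 0 it behaves like ((N+al)/2)^2 / r^2, and this coefficient is kept
    entirely, since it enters the constants Xi_zero. *)
Lemma ile_radial_div al p : C1c p ->
  ile (fun r => ((n%:R + 1 + al%:R) / 2) ^+ 2 * wsq al.+2 p r +
                n%:R * (n%:R - 2) / 8 * wsq al p r)
      (wsq al (radial_div p)).
Proof.
move=> pC; apply: (@ile_weight _ n al (n%:R / 2) ((al%:R + 1) / 2) 0 p) => // r r0 /=.
rewrite wsqS2 /wsq; have := weight_ge0 n al r0.
have := coth2_ge r0; have := coth_ge_inv r0; rewrite -exprVn.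
have i0 : 0 <= r^-1 by rewrite invr_ge0 ltW.
have a0 : 0 <= al%:R :> R by [].
have b0 : 0 <= n%:R :> R by [].
rewrite /radial_div; move: i0 a0 b0; set a : R := al%:R; set b : R := n%:R.
set w := weight _ _ r; set c := coth r; set i := r^-1; set x := p r; set y := derive1 p r.
move=> i0 a0 b0 ci c2 w0; rewrite -subr_ge0.
rewrite (_ : _ - _ = ((y + (b / 2 * c - (a + 1) / 2 * i) * x) ^+ 2 +
  x ^+ 2 * ((b / 4 * (b + 2)) * (c ^+ 2 - (i ^+ 2 + 1 / 2)) +
   b * a / 2 * (i * (c - i)))) * w); last by field.
rewrite mulr_ge0//.
rewrite addr_ge0 ?sqr_ge0// mulr_ge0 ?sqr_ge0// addr_ge0//.
  by rewrite mulr_ge0 ?subr_ge0// mulr_ge0//; lra.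
by rewrite mulr_ge0 ?divr_ge0 ?mulr_ge0 ?subr_ge0.
Qed.

End first_order.

(** * Iterates of the radial Laplacian on a ray *)

Section iterates.
Context {R : realType}.
Variable n : nat.
Implicit Types (f g p : R -> R) (v : nat -> R -> R) (r : R).
Local Notation E := (wsq n).

(** The restrictions to a ray of the iterated radial Laplacians of a test
    function. *)
Definition lap_seq v := forall j,
  [/\ C1c (v j), C1c (derive1 (v j)) &
      forall r, 0 < r -> v j.+1 r = radial_div n (derive1 (v j)) r].

Lemma lap_seq_shift v j : lap_seq v -> lap_seq (fun i => v (j + i)%N).
Proof.
by move=> vl i; have [? ? H] := vl (j + i)%N; split=> // r r0; rewrite addnS H.
Qed.

Lemma wsq_ge0 al f r : 0 < r -> 0 <= E al f r.
Proof. by move=> r0; rewrite /wsq mulr_ge0 ?sqr_ge0// weight_ge0. Qed.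

Lemma ile_lap al v g : lap_seq v -> ile g (E al (radial_div n (derive1 (v 0%N)))) ->
  ile g (E al (v 1%N)).
Proof.
move=> /(_ 0%N)[_ _ H] /ile_trans; apply; apply: ile_le => r r0.
by rewrite /wsq H.
Qed.

(** Half of the zeroth order term of [ile_radial_div] is spent on the Hardy
    inequality; [rellich_top] is the other half, spent on Poincare. *)
Definition rellich_mid al : R := n%:R * (n%:R - 2) / 16 * ((n%:R - al%:R - 1) / 2) ^+ 2.
Definition rellich_top al : R := n%:R * (n%:R - 2) / 16 * ((n%:R - al%:R) / 2) ^+ 2.

(** [ile_radial_div] followed, on its leading term, by the Hardy inequality with
    exponent al + 2 and, on its last term, by one half each of the Hardy and of
    the Poincare inequality with exponent al. *)
Lemma ile_rellich al v : (al + 2 < n)%N -> lap_seq v ->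
  ile (fun r =>
         (n.+1%:R + al%:R) ^+ 2 * (n.+1%:R - al%:R - 4) ^+ 2 / 16 * E al.+4 (v 0%N) r
         + rellich_mid al * E al.+2 (v 0%N) r + rellich_top al * E al (v 0%N) r)
      (E al (v 1%N)).
Proof.
move=> aln vl; apply: ile_lap => //; have [v0 v1 _] := vl 0%N.
apply: ile_trans (ile_radial_div n al v1).
have n2 : 0 <= n%:R - 2 :> R by rewrite subr_ge0 ler_nat; lia.
pose b : R := n%:R * (n%:R - 2) / 16.
have b0 : 0 <= b by rewrite /b divr_ge0 // mulr_ge0.
have a0 : 0 <= ((n%:R + 1 + al%:R) / 2) ^+ 2 :> R by exact: sqr_ge0.
have H1 := ileZ a0 (@ile_hardy _ n al.+2 _ ltac:(lia) v0).
have H2 := ileZ b0 (@ile_hardy _ n al _ ltac:(lia) v0).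
have H3 := ileZ b0 (@ile_poincare _ n al _ ltac:(lia) v0).
have := ileD H1 (ileD H2 H3) => H.
apply: ile_eql (ile_trans H _) => [r r0|]; last first.
  by apply: ile_le => r r0; rewrite /b; lra.
by rewrite /rellich_mid /rellich_top /b -!natr1; field.
Qed.

Lemma Xi_zeroS (al : R) m : Xi_zero n.+1 al m.+1 =
  (n.+1%:R + al) ^+ 2 * (n.+1%:R - al - 4) ^+ 2 / 16 * Xi_zero n.+1 (al + 4) m.
Proof.
rewrite /Xi_zero big_ord_recl mulr0 addr0 subr0; congr (_ * _).
apply: eq_bigr => i _; have -> : (bump 0 i)%:R = i%:R + 1 :> R by rewrite natr1.
by congr (_ ^+ 2 * _ ^+ 2 / _); ring.
Qed.

Lemma rellich_mid_gt0 al : (al + 2 < n)%N -> 0 < rellich_mid al.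
Proof.
move=> an; have n2 : 0 < n%:R - 2 :> R by rewrite subr_gt0 ltr_nat; lia.
have n0 : 0 < n%:R :> R by rewrite ltr0n; lia.
have : al%:R + 2 < n%:R :> R by rewrite -natrD ltr_nat.
move=> H; rewrite /rellich_mid mulr_gt0// ?divr_gt0 ?mulr_gt0 ?exprn_gt0 ?divr_gt0//; lra.
Qed.

Lemma rellich_top_gt0 al : (al + 2 < n)%N -> 0 < rellich_top al.
Proof.
move=> an; have n2 : 0 < n%:R - 2 :> R by rewrite subr_gt0 ltr_nat; lia.
have n0 : 0 < n%:R :> R by rewrite ltr0n; lia.
have : al%:R + 2 < n%:R :> R by rewrite -natrD ltr_nat.
move=> H; rewrite /rellich_top mulr_gt0// ?divr_gt0 ?mulr_gt0 ?exprn_gt0 ?divr_gt0//; lra.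
Qed.

(** The leading term is iterated with al + 4; the positive term in r^(-al) is
    iterated with the same al.  Powers of 1/r between the last two exponents are not
    tracked, since they are dominated by the sum of the extreme ones
    ([wsq_interp]). *)
Lemma ile_rellich_iter m al : (al + 4 * m.+1 <= n)%N ->
  exists2 e : R, 0 < e & forall v, lap_seq v ->
  ile (fun r => Xi_zero n.+1 al%:R m.+1 * E (al + 4 * m.+1) (v 0%N) r
         + e * E (al + 4 * m + 2) (v 0%N) r + e * E al (v 0%N) r)
      (E al (v m.+1)).
Proof.
elim: m al => [|m IH] al aln.
  exists (Num.min (rellich_mid al) (rellich_top al)).
    by rewrite lt_min rellich_mid_gt0 ?rellich_top_gt0//; lia.
  move=> v vl; apply: ile_trans (@ile_rellich al v ltac:(lia) vl).
  apply: ile_le => r r0; rewrite muln1 muln0 addn0 addn4 addn2.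
  rewrite Xi_zeroS {1}/Xi_zero big_ord0 mulr1.
  rewrite lerD ?ler_wpM2r ?wsq_ge0 ?ge_min ?lexx ?orbT//.
  by rewrite lerD2l ler_wpM2r ?wsq_ge0 ?ge_min ?lexx ?orbT.
have [e e0 He] := IH (al + 4)%N ltac:(lia).
have [f f0 Hf] := IH al ltac:(lia).
pose a : R := (n.+1%:R + al%:R) ^+ 2 * (n.+1%:R - al%:R - 4) ^+ 2 / 16.
have a0 : 0 < a.
  have H : (al + 4)%:R < n.+1%:R :> R by rewrite ltr_nat; lia.
  rewrite natrD in H; have al0 : 0 <= al%:R :> R by [].
  by rewrite /a divr_gt0 ?mulr_gt0 ?exprn_gt0//; lra.
have t0 : 0 < rellich_top al by rewrite rellich_top_gt0//; lia.
(* The coefficient of r^(-al) comes from the last term, the other from the leading one. *)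
exists (Num.min (a * e) (rellich_top al * f)).
  by rewrite lt_min mulr_gt0//= mulr_gt0.
move=> v vl.
have H := @ile_rellich al (fun i => v (m.+1 + i)%N) ltac:(lia) (lap_seq_shift _ vl).
rewrite addn1 addn0 in H; apply: ile_trans H.
have H := ileD (ileZ (ltW a0) (He _ vl)) (ileZ (ltW t0) (Hf _ vl)).
apply: (ile_trans (ile_trans _ H)); last first.
  apply: ile_le => r r0; rewrite addn4 -/a lerD2r lerDl.
  by rewrite mulr_ge0 ?wsq_ge0// ltW// rellich_mid_gt0//; lia.
apply: ile_le => r r0.
rewrite (_ : (al + 4 + 4 * m.+1)%N = (al + 4 * m.+2)%N); last by lia.
rewrite (_ : (al + 4 + 4 * m + 2)%N = (al + 4 * m.+1 + 2)%N); last by lia.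
rewrite Xi_zeroS -/a natrD.
set X := Xi_zero _ _ _; set A := E _ _ r; set B := E _ _ r; set C := E al _ r.
have B0 : 0 <= B by exact: wsq_ge0. have C0 : 0 <= C by exact: wsq_ge0.
set e1 := Num.min _ _.
have e1e : e1 * B <= a * e * B by rewrite ler_wpM2r// /e1 ge_min lexx.
have e1f : e1 * C <= rellich_top al * f * C by rewrite ler_wpM2r// /e1 ge_min lexx orbT.
set D := E _ _ r; set F := E _ _ r; set G := E _ _ r.
have r1 : 0 <= a * e * D by rewrite mulr_ge0 ?wsq_ge0// mulr_ge0// ltW.
have r2 : 0 <= rellich_top al * f * G by rewrite mulr_ge0 ?wsq_ge0// mulr_ge0// ltW.
have r3 : 0 <= rellich_top al * (Xi_zero n.+1 al%:R m.+1 * F).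
  rewrite mulr_ge0 ?(ltW t0)// mulr_ge0 ?wsq_ge0//.
  rewrite /Xi_zero; apply: prodr_ge0 => i _.
  by apply: divr_ge0 => //; apply: mulr_ge0; exact: sqr_ge0.
lra.
Qed.

End iterates.

(** * The inequality on a ray *)

Section ray_iterates.
Context {R : realType}.
Variable n : nat.
Hypothesis n6 : (6 <= n)%N.
Implicit Types (f g : R -> R) (v : nat -> R -> R) (r : R).
Local Notation E := (wsq n).
Local Notation lap_seq := (lap_seq n).

Let n6R : 6 <= n%:R :> R. Proof. by rewrite ler_nat. Qed.

Lemma Xi_zero_gt0 al m : (al + 4 * m <= n)%N -> 0 < Xi_zero n.+1 al%:R m :> R.
Proof.
move=> H; apply: prodr_gt0 => i _.
have : (al + 4 * i + 4)%:R < n.+1%:R :> R by rewrite ltr_nat; have := ltn_ord i; lia.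
rewrite 2!natrD natrM => Hi.
have al0 : 0 <= al%:R :> R by []. have i0 : 0 <= i%:R :> R by [].
apply: divr_gt0 => //; apply: mulr_gt0; apply: exprn_gt0; lra.
Qed.

Lemma Xi_topE (al : R) m : Xi_top n.+1 al m = (n%:R / 4) ^+ (2 * m).
Proof. by rewrite /Xi_top -natr1 addrK. Qed.

Lemma Xi_topS (al : R) m : Xi_top n.+1 al m.+1 = n%:R ^+ 2 / 16 * Xi_top n.+1 al m.
Proof.
by rewrite !Xi_topE mulnS exprD; congr (_ * _); field.
Qed.

Lemma Xi_top_gt0 (al : R) m : 0 < Xi_top n.+1 al m.
Proof. by have := n6R; rewrite Xi_topE => ?; rewrite exprn_gt0// divr_gt0//; lra. Qed.

(** The excess over the factor (n/4)^2 of Xi_top is what makes room for the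
    intermediate constants C_i. *)
Lemma rellich_top2 : n%:R ^+ 2 / 16 < rellich_top n 2 :> R.
Proof.
rewrite /rellich_top; move: n6R; set x : R := n%:R => x6.
rewrite -subr_gt0 (_ : _ - _ = x / 64 * ((x - 2) ^+ 3 - 4 * x)); last by field.
apply: mulr_gt0; first by lra.
have -> : (x - 2) ^+ 3 - 4 * x =
  (x - 6) ^+ 3 + 12 * (x - 6) ^+ 2 + 44 * (x - 6) + 40 by ring.
have t0 : 0 <= x - 6 by rewrite subr_ge0.
by rewrite ltr_wpDl// !addr_ge0 ?mulr_ge0 ?exprn_ge0.
Qed.

Lemma ile_rellich_top v : lap_seq v ->
  ile (fun r => n%:R ^+ 2 / 16 * E 2 (v 0%N) r) (E 2 (v 1%N)).
Proof.
move=> vl; apply: ile_trans (@ile_rellich R n 2 v ltac:(lia) vl).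
apply: ile_le => r r0; rewrite -[leLHS]add0r lerD//.
  apply: addr_ge0; apply: mulr_ge0; rewrite ?wsq_ge0//.
    by apply: divr_ge0 => //; apply: mulr_ge0; exact: sqr_ge0.
  by apply/ltW/rellich_mid_gt0; lia.
by rewrite ler_wpM2r ?wsq_ge0// ltW// rellich_top2.
Qed.

Lemma ile_Xi_top m v : lap_seq v ->
  ile (fun r => Xi_top n.+1 2 m * E 2 (v 0%N) r) (E 2 (v m)).
Proof.
elim: m => [|m IH] vl.
  by apply: ile_le => r r0; rewrite Xi_topE expr0 mul1r.
have H := ile_rellich_top (lap_seq_shift m vl).
rewrite addn1 addn0 in H; apply: ile_trans H.
have c0 : 0 <= n%:R ^+ 2 / 16 :> R by rewrite divr_ge0 ?sqr_ge0.
apply: ile_trans (ileZ c0 (IH vl)).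
by apply: ile_le => r r0; rewrite Xi_topS -[leLHS]mulrA lexx.
Qed.

(** The step closest to the weight r^(-2) uses [ile_rellich] with exponent 2.  Its
    leading term is iterated by [ile_rellich_iter] with exponent 6, since
    Xi_zero for alpha = 2 continues with the factors of alpha = 6; its last term is
    iterated by [ile_Xi_top]. *)
Lemma ile_Xi m : (4 * m.+1 + 2 <= n)%N ->
  exists2 e : R, 0 < e & forall v, lap_seq v ->
  ile (fun r => Xi_zero n.+1 2 m.+1 * E (4 * m.+1 + 2) (v 0%N) r
         + e * E (4 * m.+1) (v 0%N) r + (Xi_top n.+1 2 m.+1 + e) * E 2 (v 0%N) r)
      (E 2 (v m.+1)).
Proof.
case: m => [|m] mn.
  exists (Num.min (rellich_mid n 2) (rellich_top n 2 - n%:R ^+ 2 / 16)).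
    by rewrite lt_min rellich_mid_gt0 /= ?subr_gt0 ?rellich_top2//; lia.
  move=> v vl; apply: ile_trans (@ile_rellich R n 2 v ltac:(lia) vl).
  apply: ile_le => r r0; rewrite !muln1 addn2.
  rewrite Xi_zeroS {1}/Xi_zero big_ord0 mulr1 lerD//.
    by rewrite lerD2l ler_wpM2r ?wsq_ge0// ge_min lexx.
  rewrite ler_wpM2r ?wsq_ge0// -lerBrDl Xi_topS Xi_topE expr0 mulr1.
  by rewrite ge_min lexx orbT.
have [e e0 He] := @ile_rellich_iter R n m 6 ltac:(lia).
pose a : R := (n.+1%:R + 2) ^+ 2 * (n.+1%:R - 2 - 4) ^+ 2 / 16.
have a0 : 0 < a.
  by rewrite /a -natr1; move: n6R => ?; rewrite divr_gt0 ?mulr_gt0 ?exprn_gt0//; lra.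
have t0 : 0 < rellich_top n 2 :> R by rewrite rellich_top_gt0//; lia.
pose d : R := (rellich_top n 2 - n%:R ^+ 2 / 16) * Xi_top n.+1 (2 : R) m.+1.
have d0 : 0 < d by rewrite /d mulr_gt0 ?Xi_top_gt0// subr_gt0 rellich_top2.
exists (Num.min (a * e) d); first by rewrite lt_min d0 mulr_gt0.
move=> v vl.
have H := @ile_rellich R n 2 (fun i => v (m.+1 + i)%N) ltac:(lia) (lap_seq_shift _ vl).
rewrite addn1 addn0 in H; apply: ile_trans H.
have H := ileD (ileZ (ltW a0) (He _ vl)) (ileZ (ltW t0) (ile_Xi_top m.+1 vl)).
apply: (ile_trans (ile_trans _ H)); last first.
  apply: ile_le => r r0; rewrite -/a lerD2r lerDl.
  by rewrite mulr_ge0 ?wsq_ge0// ltW// rellich_mid_gt0//; lia.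
apply: ile_le => r r0.
rewrite (_ : (6 + 4 * m.+1)%N = (4 * m.+2 + 2)%N); last by lia.
rewrite (_ : (6 + 4 * m + 2)%N = (4 * m.+2)%N); last by lia.
rewrite Xi_zeroS -/a (_ : 2 + 4 = 6%:R :> R); last by rewrite -natrD.
rewrite Xi_topS.
set X := Xi_zero _ _ _; set A := E _ _ r; set B := E _ _ r; set C := E 2 _ r.
have B0 : 0 <= B by exact: wsq_ge0. have C0 : 0 <= C by exact: wsq_ge0.
set e1 := Num.min _ _.
have e1e : e1 * B <= a * e * B by rewrite ler_wpM2r// /e1 ge_min lexx.
have e1f : e1 * C <= d * C by rewrite ler_wpM2r// /e1 ge_min lexx orbT.
rewrite /d in e1f.
set G := E _ _ r.
have r1 : 0 <= a * e * G by rewrite mulr_ge0 ?wsq_ge0// mulr_ge0// ltW.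
lra.
Qed.

(** The remainder 1/4 int v'^2 / r^2 of [ile_radial_div0] is converted with the
    Poincare inequality; (n - 2)^2 / 16 exceeds the value n / 16 that enters
    C_{k-1,l}^1. *)
Lemma ile_lap_gradient v : lap_seq v ->
  ile (fun r => (n%:R / 2) ^+ 2 * E 0 (derive1 (v 0%N)) r
                + (n%:R - 2) ^+ 2 / 16 * E 2 (v 0%N) r) (E 0 (v 1%N)).
Proof.
move=> vl; apply: ile_lap => //; have [v0 v1 _] := vl 0%N.
apply: ile_trans (ile_radial_div0 n v1).
apply: ileD; first by exact: ile_le.
have h0 : 0 <= 1 / 4 :> R by lra.
apply: ile_trans (ileZ h0 (@ile_poincare R n 2 _ ltac:(lia) v0)).
by apply: ile_le => r r0; rewrite le_eqVlt; apply/orP; left; apply/eqP; field.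
Qed.

(** The coefficient n^2 + (n - 2)^2 obtained for 16 v^2 / r^2 is at least
    N n = n^2 + n. *)
Lemma ile_lap_poincare v : lap_seq v ->
  ile (fun r => (n%:R / 2) ^+ 4 * E 0 (v 0%N) r
                + n.+1%:R * n%:R / 16 * E 2 (v 0%N) r) (E 0 (v 1%N)).
Proof.
move=> vl; apply: ile_trans (ile_lap_gradient vl); have [v0 _ _] := vl 0%N.
have c0 : 0 <= (n%:R / 2) ^+ 2 :> R by exact: sqr_ge0.
have H := ileZ c0 (@ile_poincare_hardy R n _ ltac:(lia) v0).
have h0 : 0 <= (n%:R - 2) ^+ 2 / 16 :> R by rewrite divr_ge0 ?sqr_ge0.
have H' : ile (fun r => (n%:R - 2) ^+ 2 / 16 * E 2 (v 0%N) r)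
   (fun r => (n%:R - 2) ^+ 2 / 16 * E 2 (v 0%N) r) by apply: ile_le.
apply: (ile_trans _ (ileD H H')); apply: ile_le => r r0.
have C0 : 0 <= E 2 (v 0%N) r by exact: wsq_ge0.
rewrite -natr1; move: n6R C0; set x : R := n%:R; set C := E 2 _ _; set A := E 0 _ _.
move=> x6 C0; rewrite -subr_ge0.
rewrite (_ : _ - _ = ((x - 2) ^+ 2 - x) / 16 * C); last by field.
by rewrite mulr_ge0//; nra.
Qed.

(** The term j = 1 of the sum for p + 1 is the one produced by the innermost use of
    [ile_lap_poincare]; the others are those for p, multiplied by the factor
    n^2/16 of [ile_rellich_top]. *)
Lemma C1_even_zeroS p : C1_even_zero R n.+1 (2 * p.+1) =
  (n%:R / 2) ^+ (4 * p) * (n.+1%:R * n%:R / 16) +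
  C1_even_zero R n.+1 (2 * p) * (n%:R ^+ 2 / 16).
Proof.
rewrite /C1_even_zero ![(2 * _)%N]mulnC !mulnK// -(natr1 n) addrK.
rewrite big_nat_recl// mulrDr; congr (_ + _).
  rewrite (_ : (4 * p.+1 - 1 * 2 - 2)%N = (4 * p)%N); last by lia.
  rewrite mulnS exprD expr_div_n; field.
  by rewrite expf_neq0// pnatr_eq0.
set S := (X in _ = _ * X * _).
rewrite (_ : \sum_(_ <= _ < _) _ = n%:R ^+ 2 * S); last first.
  rewrite mulr_sumr; apply: eq_big_nat => i /andP[i1 ip].
  by rewrite -exprD; congr (_ ^+ _); lia.
rewrite mulnS exprD; field.
by rewrite expf_neq0// pnatr_eq0.
Qed.

Lemma ile_lap_iter p v : lap_seq v ->
  ile (fun r => (n%:R / 2) ^+ (4 * p) * E 0 (v 0%N) r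
                + C1_even_zero R n.+1 (2 * p) * E 2 (v 0%N) r) (E 0 (v p)).
Proof.
elim: p v => [|p IH] v vl.
  apply: ile_le => r r0; rewrite !muln0 expr0 /C1_even_zero div0n big_geq//.
  by rewrite mulr0 mul0r addr0 mul1r.
have H := IH _ (lap_seq_shift 1 vl); rewrite addn0 add1n in H.
apply: ile_trans H.
have c0 : 0 <= (n%:R / 2) ^+ (4 * p) :> R by rewrite exprn_ge0// divr_ge0.
have d0 : 0 <= C1_even_zero R n.+1 (2 * p).
  rewrite /C1_even_zero -{2 3}natr1 addrK; apply: mulr_ge0.
    by apply: divr_ge0; rewrite ?exprn_ge0// mulr_ge0.
  by apply: sumr_ge0 => i _; rewrite exprn_ge0.
apply: ile_trans (ileD (ileZ c0 (ile_lap_poincare vl)) (ileZ d0 (ile_rellich_top vl))).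
apply: ile_le => r r0; rewrite C1_even_zeroS mulnS addnC exprD.
by rewrite le_eqVlt; apply/orP; left; apply/eqP; ring.
Qed.

End ray_iterates.

Section ray_inequality.
Context {R : realType}.
Variable n : nat.
Hypothesis n6 : (6 <= n)%N.
Implicit Types (f g : R -> R) (v : nat -> R -> R) (r : R).
Local Notation E := (wsq n).
Local Notation lap_seq := (lap_seq n).

Let n6R : 6 <= n%:R :> R. Proof. by rewrite ler_nat. Qed.

(** r^(-be) is at most r^(-al) for r >= 1 and at most r^(-ga) for r <= 1. *)
Lemma wsq_interp al be ga f r : 0 < r -> (al <= be <= ga)%N ->
  E be f r <= E al f r + E ga f r.
Proof.
move=> r0 /andP[ab bc].
rewrite /wsq -mulrDr; apply: ler_wpM2l; first exact: sqr_ge0.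
rewrite /weight -mulrDr; apply: ler_wpM2l; first by rewrite exprn_ge0// ltW// sinh_gt0.
have i0 k : 0 <= (r ^+ k)^-1 by rewrite invr_ge0 exprn_ge0// ltW.
have [r1|r1] := lerP 1 r.
  rewrite -[leLHS]addr0 lerD//.
  by rewrite lef_pV2 ?posrE ?exprn_gt0// ler_weXn2l.
rewrite -[leLHS]add0r lerD//.
by rewrite lef_pV2 ?posrE ?exprn_gt0// ler_wiXn2l// ltW.
Qed.

Lemma sum_wsq_interp (e : R) k f r : (2 < k)%N -> 0 < r -> 0 <= e ->
  \sum_(2 <= i < k) e / k%:R * E (2 * i) f r <=
  e * (E 2 f r + E (2 * k.-1) f r).
Proof.
move=> k2 r0 e0; set S := E 2 _ _ + _.
have k0 : (0 : R) < k%:R by rewrite ltr0n (ltn_trans _ k2).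
have S0 : 0 <= S by rewrite addr_ge0 ?wsq_ge0.
apply: (@le_trans _ _ (\sum_(2 <= i < k) e / k%:R * S)).
  rewrite big_nat_cond [leRHS]big_nat_cond; apply: ler_sum => i /andP[/andP[i2 ik] _].
  rewrite ler_wpM2l ?divr_ge0//; apply: wsq_interp => //.
  by rewrite leq_pmulr ?(ltnW i2)// leq_pmul2l// -ltnS prednK// (ltn_trans _ k2).
have -> : \sum_(2 <= i < k) e / k%:R * S = ((k - 2)%:R / k%:R) * (e * S).
  by rewrite sumr_const_nat -[LHS]mulr_natl; field; rewrite gt_eqF.
rewrite ler_piMl ?mulr_ge0//.
by rewrite ler_pdivrMr// mul1r ler_nat leq_subr.
Qed.

(** The constant that the argument gives in front of int u^2 / r^2 when
    int (Delta_r^(h+1+q) u)^2 is brought down to int |(Delta_r^h u)'|^2.  It is at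
    least the corresponding C_{k-1,l}^1 when q > 0 ([grad_const_ge]). *)
Definition grad_const h q : R :=
  (n%:R / 2) ^+ (4 * q) * ((n%:R - 2) ^+ 2 / 16) * Xi_top n.+1 (2 : R) h
  + C1_even_zero R n.+1 (2 * q) * Xi_top n.+1 (2 : R) h.+1.

Lemma C1_even_zero_ge0 q : 0 <= C1_even_zero R n.+1 q.
Proof.
rewrite /C1_even_zero -(natr1 n) addrK; apply: mulr_ge0.
  by apply: divr_ge0; rewrite ?exprn_ge0// mulr_ge0// addr_ge0.
by apply: sumr_ge0 => i _; rewrite exprn_ge0.
Qed.

Lemma C1_even_zero0 : C1_even_zero R n.+1 0 = 0.
Proof. by rewrite /C1_even_zero div0n big_geq// mulr0. Qed.

Lemma ile_lap_iter_grad h q v : lap_seq v ->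
  ile (fun r => (n%:R / 2) ^+ (4 * q) * ((n%:R / 2) ^+ 2 * E 0 (derive1 (v h)) r)
                + grad_const h q * E 2 (v 0%N) r)
      (E 0 (v (h.+1 + q)%N)).
Proof.
move=> vl.
have A2 := ile_lap_iter n6 q (lap_seq_shift h.+1 vl); rewrite addn0 in A2.
have A3 := ile_lap_gradient n6 (lap_seq_shift h vl); rewrite addn1 addn0 in A3.
have A4 := ile_Xi_top n6 h vl.
have A5 := ile_Xi_top n6 h.+1 vl.
have k0 : 0 <= (n%:R / 2) ^+ (4 * q) :> R by rewrite exprn_ge0// divr_ge0.
have g0 : 0 <= (n%:R - 2) ^+ 2 / 16 :> R by rewrite divr_ge0 ?sqr_ge0.
have c0 := C1_even_zero_ge0 (2 * q).
apply: (ile_trans _ A2).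
apply: (ile_trans _ (ileD (ileZ k0 A3) (ileZ c0 A5))).
pose F r := (n%:R / 2) ^+ (4 * q) * ((n%:R / 2) ^+ 2 * E 0 (derive1 (v h)) r)
    + C1_even_zero R n.+1 (2 * q) * (Xi_top n.+1 2 h.+1 * E 2 (v 0%N) r).
have FF : ile F F by exact: ile_le.
apply: (ile_trans (ile_trans _ (ileD FF (ileZ (mulr_ge0 k0 g0) A4)))).
  apply: ile_le => r r0; rewrite /F /grad_const le_eqVlt; apply/orP; left.
  by apply/eqP; ring.
by apply: ile_le => r r0; rewrite /F le_eqVlt; apply/orP; left; apply/eqP; ring.
Qed.

Lemma grad_const_ge h q : n%:R ^+ (4 * q + 1) / 2 ^+ (4 * q + 4) *
  Xi_top n.+1 (2 : R) h + C1_even_zero R n.+1 (2 * q) * Xi_top n.+1 (2 : R) h.+1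
  <= grad_const h q.
Proof.
have Xh0 := Xi_top_gt0 n6 (2 : R) h.
rewrite /grad_const lerD2r ler_wpM2r ?(ltW Xh0)//.
have -> : n%:R ^+ (4 * q + 1) / 2 ^+ (4 * q + 4) =
    (n%:R / 2) ^+ (4 * q) * (n%:R / 16) :> R.
  by rewrite !exprD expr1 expr_div_n; field; rewrite expf_neq0// pnatr_eq0.
rewrite ler_wpM2l ?ler_wpM2r// ?exprn_ge0 ?divr_ge0//.
by move: n6R; nra.
Qed.

Lemma sum_ends (F : nat -> R) k : (2 < k)%N ->
  \sum_(1 <= i < k.+1) F i = F 1%N + \sum_(2 <= i < k) F i + F k.
Proof.
by move=> k2; rewrite big_nat_recr ?(ltnW (ltnW k2))// big_ltn// (ltn_trans _ k2).
Qed.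

(** The constants C_1 and C_k have their prescribed values; the intermediate ones are
    all equal to e / (4 k), where e is the excess in [ile_Xi]. *)
Lemma ile_ray k l m h : k = (2 * m + 1)%N -> l = (2 * h + 1)%N -> (l < k)%N ->
  (2 * k < n.+1)%N ->
  exists C : nat -> R,
    [/\ forall i, 0 < C i,
        C k = 1 / 4 * Xi_zero n.+1 2 ((k - 1) %/ 2),
        C 1%N = (if (m - h)%N != 1%N then
                   1 / 4 * Xi_top n.+1 2 ((k - 1) %/ 2) +
                   (n.+1%:R - 1) ^+ 2 / 4 * C1_pred_odd R n.+1 k l
                 else
                   (n.+1%:R - 1) ^+ 3 / 2 ^+ 6 * Xi_top n.+1 2 ((l - 1) %/ 2) +
                   1 / 4 * Xi_top n.+1 2 ((l + 1) %/ 2)) &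
        forall v, lap_seq v ->
          ile (fun r => \sum_(1 <= i < k.+1) C i * E (2 * i) (v 0%N) r
                 + (n%:R / 2) ^+ (4 * (m - h)) * E 0 (derive1 (v h)) r)
              (E 0 (derive1 (v m)))].
Proof.
move=> kE lE lk kn.
have hm : (h < m)%N by lia.
case: m hm kE => // m hm kE.
(* After the case analysis, m stands for the predecessor of the original m. *)
pose q := (m - h)%N.
have mE : m.+1 = (h.+1 + q)%N by rewrite /q; lia.
have mh : (m.+1 - h)%N = q.+1 by lia.
have -> : ((k - 1) %/ 2)%N = m.+1 by rewrite kE addnK mulnC mulnK.
have lh : ((l - 1) %/ 2)%N = h by rewrite lE addnK mulnC mulnK.
have lh1 : ((l + 1) %/ 2)%N = h.+1 by rewrite lE -addnA -mulnSr mulnC mulnK.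
have kl2 : (k - l - 2)%N = (2 * q)%N by lia.
have kl3 : (2 * k - 2 * l - 3)%N = (4 * q + 1)%N by lia.
have kl0 : (2 * k - 2 * l)%N = (4 * q + 4)%N by lia.
have mk : (4 * m.+1 + 2)%N = (2 * k)%N by lia.
have mk1 : (4 * m.+1)%N = (2 * k.-1)%N by lia.
have mn : (4 * m.+1 + 2 <= n)%N by lia.
have mn2 : (2 + 4 * m.+1 <= n)%N by lia.
have k2 : (2 < k)%N by lia.
have n1 : (1 < n)%N by lia.
have NE : n.+1%:R - 1 = n%:R :> R by rewrite -natr1 addrK.
rewrite lh lh1 mh eqSS /C1_pred_odd lh lh1 kl2 kl3 kl0 NE.
have [e e0 He] := @ile_Xi R n n6 m mn.
have Xh0 := Xi_top_gt0 n6 (2 : R) h; have Xh1 := Xi_top_gt0 n6 (2 : R) h.+1.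
have XT0 := Xi_top_gt0 n6 (2 : R) m.+1.
have X0 : 0 < Xi_zero n.+1 2 m.+1 :> R by exact: (@Xi_zero_gt0 R n n6 2 m.+1 mn2).
set C1 : R := if (_ : bool) then _ else _.
have n0 : 0 < n%:R :> R by rewrite ltr0n (ltn_trans _ n6).
have C1_gt0 : 0 < C1.
  rewrite /C1; case: ifP => _.
    apply: addr_gt0; first by rewrite mulr_gt0.
    apply: mulr_gt0; first by rewrite divr_gt0// exprn_gt0.
    apply: ltr_wpDr; first by rewrite mulr_ge0 ?C1_even_zero_ge0// ltW.
    by rewrite mulr_gt0// divr_gt0// exprn_gt0.
  by apply: addr_gt0; apply: mulr_gt0 => //; rewrite divr_gt0// exprn_gt0.
have C1B : C1 <= 1 / 4 * Xi_top n.+1 2 m.+1 + (n%:R / 2) ^+ 2 * grad_const h q.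
  have nE : (n%:R / 2) ^+ 2 = n%:R ^+ 2 / 4 :> R by field.
  rewrite /C1; case: ifP => [_|/negbFE/eqP q0].
    by rewrite lerD2l nE ler_wpM2l ?divr_ge0 ?sqr_ge0// grad_const_ge.
  rewrite mE q0 addn0 addrC lerD2l.
  apply: le_trans (ler_wpM2l (sqr_ge0 _) (grad_const_ge h 0)).
  rewrite !muln0 C1_even_zero0 mul0r addr0 !add0n expr1.
  rewrite mulrA ler_wpM2r ?(ltW Xh0)// le_eqVlt; apply/orP; left.
  by apply/eqP; field.
clearbody C1.
have k0 : (0 : R) < k%:R by rewrite ltr0n (ltn_trans _ k2).
exists (fun i => if i == 1%N then C1 else
  if i == k then 1 / 4 * Xi_zero n.+1 2 m.+1 else 1 / 4 * e / k%:R).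
have k1 : (k == 1%N) = false by rewrite gtn_eqF// (ltn_trans _ k2).
split.
- move=> i; case: ifP => _; first exact: C1_gt0.
  case: ifP => _; first by rewrite mulr_gt0.
  by rewrite divr_gt0// mulr_gt0.
- by rewrite eqxx k1.
- by rewrite eqxx.
move=> v vl.
have [vm _ _] := vl m.+1.
apply: (ile_trans _ (ile_poincare_hardy n1 vm)).
have h0 : 0 <= (n%:R / 2) ^+ 2 :> R by exact: sqr_ge0.
have q0 : 0 <= 1 / 4 :> R by [].
have A6 := ile_lap_iter_grad h q vl; rewrite -mE in A6.
apply: (ile_trans _ (ileD (ileZ h0 A6) (ileZ q0 (He v vl)))).
clear He A6 vm vl lk kn mn mn2 n6 n1 kE lE hm.
apply: ile_le => r r0.
rewrite mulnS exprD mk mk1.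
rewrite sum_ends// !eqxx k1 muln1.
rewrite (eq_big_nat _ _
  (F2 := fun i => 1 / 4 * e / k%:R * E (2 * i) (v 0%N) r)); last first.
  move=> i /andP[i2 ik]; rewrite (gtn_eqF i2) (ltn_eqF ik) //.
have e40 : 0 <= 1 / 4 * e by rewrite mulr_ge0// ltW.
have Hmid := sum_wsq_interp (v 0%N) k2 r0 e40.
have Z := mulr_ge0 (ltac:(by rewrite subr_ge0) :
  0 <= 1 / 4 * Xi_top n.+1 2 m.+1 + (n%:R / 2) ^+ 2 * grad_const h q - C1)
  (wsq_ge0 n 2 (v 0%N) r0).
have -> : (n%:R / 2) ^+ 4 = (n%:R / 2) ^+ 2 * (n%:R / 2) ^+ 2 :> R by rewrite -exprD.
move: Hmid Z; set S := \sum_(_ <= _ < _) _; set a := E 2 _ r; set b := E _ _ r.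
set c := E _ _ r; set d := E 0 _ r; set X := Xi_zero _ _ _; set Y := Xi_top _ _ _.
set M := (n%:R / 2) ^+ 2; set G := grad_const _ _; set K := (n%:R / 2) ^+ _.
move=> Hmid Z.
rewrite -subr_ge0.
rewrite (_ : _ - _ = (1 / 4 * e * (a + b) - S) +
  (1 / 4 * Y + M * G - C1) * a); last first.
  by ring.
by apply: addr_ge0 => //; rewrite subr_ge0.
Qed.

End ray_inequality.

(** * Chain rule along rays, and measurability in several variables *)

Section chain_rule.
Context {R : realType} {N : nat}.
Implicit Types (v : 'rV[R]_N -> R) (x y e : 'rV[R]_N).

(** The difference quotients of the restriction to a line are those of the
    directional derivative. *)
Lemma has_deriv_line v (z : 'rV[R]_N) e (t : R) : derivable v (z + t *: e) e ->
  has_deriv (fun t => v (z + t *: e)) t ('D_e v (z + t *: e)).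
Proof.
move=> dv.
have E : (fun h : R => h^-1 *:
     (((fun t => v (z + t *: e)) \o shift t) (h *: 1) - v (z + t *: e))) =
    (fun h : R => h^-1 *: ((v \o shift (z + t *: e)) (h *: e) - v (z + t *: e))).
  apply/funext => h /=; congr (_ *: (v _ - _)).
  by rewrite scalerDl /GRing.scale/= mulr1 addrCA.
apply: DeriveDef; first by rewrite /derivable E.
by rewrite /derive E.
Qed.

Lemma mean_value_line (g dg : R -> R) (t : R) :
  (forall s, has_deriv g s (dg s)) ->
  exists th, `|th| <= `|t| /\ g t - g 0 = t * dg th.
Proof.
move=> gd.
have cg a b : {within `[a, b], continuous g}.
  by apply: derivable_within_continuous => s _; have [] := gd s.
have [t0|t0] := lerP 0 t.
  have [c] := MVT_segment t0 (fun s _ => gd s) (cg 0 t).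
  rewrite in_itv/= => /andP[c0 ct] ->; exists c; split.
    by rewrite !ger0_norm.
  by rewrite subr0 mulrC.
have [c] := MVT_segment (ltW t0) (fun s _ => gd s) (cg t 0).
rewrite in_itv/= => /andP[c0 ct] E; exists c; split.
  by rewrite !ler0_norm ?(ltW t0)// lerN2.
by rewrite -opprB E sub0r mulrN opprK mulrC.
Qed.

(** Continuous partial derivatives give the chain rule along a ray: the increment
    from r x to z x is split into moves parallel to the axes, the mean value
    theorem is applied to each, and the intermediate points tend to r x. *)
Lemma has_deriv_ray v x (r : R) :
  (forall y i, derivable v y (delta_mx 0 i)) ->
  (forall i, continuous (fun y => 'D_(delta_mx 0 i) v y)) ->
  has_deriv (fun r => v (r *: x)) r
    (\sum_(i < N) x 0 i * 'D_(delta_mx 0 i) v (r *: x)).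
Proof.
move=> dv cv.
pose p (z : R) (j : nat) : 'rV[R]_N :=
  \row_i (r * x 0 i + if (i < j)%N then (z - r) * x 0 i else 0).
have step z (j : 'I_N) : exists th, `|th| <= `|(z - r) * x 0 j| /\
    v (p z j.+1) - v (p z j) =
    (z - r) * x 0 j * 'D_(delta_mx 0 j) v (p z j + th *: delta_mx 0 j).
  have := @mean_value_line (fun t => v (p z j + t *: delta_mx 0 j))
    (fun t => 'D_(delta_mx 0 j) v (p z j + t *: delta_mx 0 j))
    ((z - r) * x 0 j) (fun s => has_deriv_line (dv _ j)).
  move=> [th [thle H]]; exists th; split => //; rewrite -H scale0r addr0.
  congr (v _ - _); apply/rowP => i; rewrite !mxE eqxx /= ltnS leq_eqVlt val_eqE.
  have [->|ij] /= := eqVneq i j; first by rewrite ltnn addr0 mulr1.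
  by rewrite mulr0 addr0.
have {}step zj := step zj.1 zj.2.
have [th Hth] := choice step.
have Hr (j : 'I_N) : p r j + th (r, j) *: delta_mx 0 j = r *: x.
  have [+ _] := Hth (r, j); rewrite /= subrr mul0r normr0 normr_le0 => /eqP ->.
  by rewrite scale0r addr0; apply/rowP => i; rewrite !mxE subrr mul0r if_same addr0.
apply/is_derive1_caratheodory.
exists (fun z => \sum_(j < N) x 0 j *
  'D_(delta_mx 0 j) v (p z j + th (z, j) *: delta_mx 0 j)); split.
- move=> z; rewrite mulr_suml.
  transitivity (v (p z N) - v (p z 0%N)).
    congr (v _ - v _); apply/rowP => i; rewrite !mxE.
      by rewrite ltn_ord -mulrDl subrKC.
    by rewrite ltn0 addr0.
  rewrite -(telescope_sumr (fun j => v (p z j)))// big_mkord; apply: eq_bigr => j _.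
  by have [_ /= ->] := Hth (z, j); ring.
- apply: cvg_big => [|j _]; first exact: add_continuous.
  apply: cvgMl_tmp.
  have C : (fun z => p z j + th (z, j) *: delta_mx 0 j) @ r --> r *: x.
    apply/cvg_ballP => eps eps0.
    pose M := \sum_(i < N) `|x 0 i| + 1.
    have xM i : `|x 0 i| < M.
      rewrite /M ltr_pwDr// (bigD1 i)//= lerDl sumr_ge0//.
    have M0 : 0 < M by exact: le_lt_trans (normr_ge0 _) (xM j).
    near=> z.
    have zr : `|z - r| * M < eps.
      rewrite -ltr_pdivlMr// distrC; near: z.
      by apply: (@cvgr_dist_lt _ _ _ _ _ id) => //; rewrite divr_gt0.
    have xz i : `|(z - r) * x 0 i| < eps.
      by rewrite normrM; apply: le_lt_trans zr; rewrite ler_wpM2l// ltW.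
    split=> // i0 i; rewrite ord1 !mxE eqxx /= /ball /=.
    have [->|ij] := eqVneq i j.
      rewrite ltnn addr0 mulr1 opprD addrA subrr add0r normrN.
      by have [thle _] := Hth (z, j); exact: le_lt_trans thle (xz j).
    rewrite mulr0 addr0 opprD addrA subrr add0r normrN.
    by case: ifP => _; rewrite ?normr0.
  rewrite Hr; exact: (cvg_comp _ ('D_(delta_mx 0 j) v) C (cv j _)).
- by under eq_bigr do rewrite Hr.
Unshelve. all: by end_near. Qed.
End chain_rule.

Section measurability_rV.
Context {R : realType} {N : nat} {d : measure_display} {T : measurableType d}.

Lemma rational_box (O : set 'rV[R]_N) (x : 'rV[R]_N) : open O -> O x ->
  exists (q : {ffun 'I_N -> rat}) (k : nat),
    (forall i, `|x 0 i - ratr (q i)| < k.+1%:R^-1) /\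
    [set y : 'rV[R]_N | forall i, `|y 0 i - ratr (q i)| < k.+1%:R^-1] `<=` O.
Proof.
move=> oO Ox; have /nbhs_ballP[e /= e0 eO] := open_nbhs_nbhs (conj oO Ox).
have [k ke] : exists k, k.+1%:R^-1 < e / 2.
  have e20 : 0 < e / 2 by rewrite divr_gt0.
  exists (Num.trunc (e / 2)^-1).
  rewrite invf_plt ?posrE// ?ltr0n//.
  by rewrite truncnS_gt.
have rq (i : 'I_N) : exists q : rat, `|x 0 i - ratr q| < k.+1%:R^-1.
  have : x 0 i - k.+1%:R^-1 < x 0 i + k.+1%:R^-1.
    by rewrite ltrBlDr -addrA ltrDl addr_gt0// invr_gt0.
  move=> /rat_in_itvoo[q]; rewrite in_itv/= => ?; exists q.
  by rewrite ltr_distlC.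
have [q Hq] := choice rq.
exists [ffun i => q i], k; split=> [i|y /= Hy]; first by rewrite ffunE.
apply: eO; split=> // i0 i; rewrite ord1 /ball /=.
rewrite -(subrKA (ratr (q i))); apply: le_lt_trans (ler_normD _ _) _.
rewrite (splitr e) ltrD//; first exact: lt_trans (Hq i) ke.
by rewrite distrC; have := Hy i; rewrite ffunE => /lt_trans; apply.
Qed.

(** An open set of row vectors is a countable union of boxes with rational centres
    and radii, and the preimage of a box is a finite intersection of measurable
    sets. *)
Lemma measurable_continuous_row (D : set T) (X : 'I_N -> T -> R)
    (v : 'rV[R]_N -> R) : measurable D -> (forall i, measurable_fun D (X i)) ->
  continuous v -> measurable_fun D (fun t => v (\row_i X i t)).
Proof.
move=> mD mX /continuousP cv; apply: (measurability _ (RGenOpens.measurableE R)).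
move=> _ [_ [a [b ->] <-]].
have /cv oO : open `]a, b[%classic by exact: interval_open.
set O := v @^-1` _ in oO.
pose box (q : {ffun 'I_N -> rat}) (k : nat) : set 'rV[R]_N :=
  [set y | forall i, `|y 0 i - ratr (q i)| < k.+1%:R^-1].
(* Indexed by all boxes; those that are not contained in O contribute nothing. *)
pose B (p : {ffun 'I_N -> rat} * nat) : set T :=
  if pselect (box p.1 p.2 `<=` O)
  then D `&` [set t | box p.1 p.2 (\row_i X i t)] else set0.
rewrite (_ : _ `&` _ = \bigcup_p B p); last first.
  apply/seteqP; split=> [t [Dt Ot]|t [p _]].
    have [q [k [H1 H2]]] := rational_box oO Ot.
    exists (q, k) => //; rewrite /B; case: pselect => //= _; split => //.
  rewrite /B; case: pselect => //= H [Dt /H]; by split.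
apply: countable_bigcupT_measurable => // p; rewrite /B.
case: pselect => /= [bO|_]; last exact: measurable0.
rewrite (_ : _ `&` _ = D `&` \bigcap_(i in [set: 'I_N])
   (D `&` X i @^-1` (ball (ratr (p.1 i) : R) (p.2.+1%:R^-1 : R)))); last first.
  apply/seteqP; split=> [t [Dt Ht]|t [Dt Ht]]; split => //.
    by move=> i _; split=> //; have := Ht i; rewrite mxE /ball/= distrC.
  by move=> i; have [_] := Ht i I; rewrite mxE /ball/= distrC.
apply: measurableI => //; apply: fin_bigcap_measurable => // i _.
by apply: mX => //; exact: measurable_ball.
Qed.

End measurability_rV.

(** * Polar functions built from a smooth function *)

Section half_space.
Context {R : realType} {N : nat}.
Local Notation half := [set p : R * N.-tuple R | 0 < p.1].

Lemma measurable_half : measurable half.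
Proof.
rewrite (_ : half = `]0, +oo[%classic `*` setT); first exact: measurableX.
by apply/seteqP; split => -[r s]; rewrite /half /= in_itv/= andbT // => -[].
Qed.

Lemma measurable_on_half (f : R -> R) : (forall r, 0 < r -> {for r, continuous f}) ->
  measurable_fun half (fun p : R * N.-tuple R => f p.1).
Proof.
move=> cf.
rewrite (_ : (fun _ => _) = f \o fst); last exact/funext.
apply: (@measurable_comp _ _ _ (R * N.-tuple R)%type R R
  (`]0, +oo[%classic : set R) f half fst) => //.
- by move=> r [p +] <-; rewrite /half /= in_itv/= andbT.
- apply: open_continuous_measurable_fun; first exact: interval_open.
  by move=> r; rewrite inE /= in_itv/= andbT => /cf.
- by apply: measurable_funTS; exact: measurable_fst.
Qed.

Lemma measurable_coord i : measurable_fun half (fun p => tnth p.2 i).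
Proof.
apply: measurable_funTS.
rewrite (_ : (fun _ => _) = (fun s : N.-tuple R => tnth s i) \o snd); last exact/funext.
by apply: measurableT_comp => //; exact: measurable_tnth.
Qed.

Lemma tuple_norm1_le (s : N.-tuple R) i : tuple_norm s = 1 -> `|tnth s i| <= 1.
Proof.
move=> s1; rewrite -s1 /tuple_norm -sqrtr_sqr ler_wsqrtr//.
rewrite (bigD1 i)//= lerDl; apply: sumr_ge0 => j _; exact: sqr_ge0.
Qed.

End half_space.

Section polar_class.
Context {R : realType} {N : nat}.
Variable u : 'rV[R]_N -> R.
Hypothesis su : smooth u.
Implicit Types F G : polar_fun R N.
Local Notation half := [set p : R * N.-tuple R | 0 < p.1].

Definition iter_partial (w : seq 'I_N) := foldr (fun i f => 'D_(delta_mx 0 i) f) u w.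

(** Polynomials in coth r, the coordinates of s and the iterated partial derivatives of
    u at r s.  This class is stable under radial derivatives ([polar_poly_deriv]), and
    measurability and boundedness of its members follow by induction on their
    construction. *)
Inductive polar_poly : polar_fun R N -> Prop :=
| polar_partial w : polar_poly (in_polar (iter_partial w))
| polar_coord i : polar_poly (fun _ s => tnth s i)
| polar_coth : polar_poly (fun r _ => coth r)
| polar_cst (c : R) : polar_poly (fun _ _ => c)
| polar_add F G : polar_poly F -> polar_poly G ->
    polar_poly (fun r s => F r s + G r s)
| polar_mul F G : polar_poly F -> polar_poly G ->
    polar_poly (fun r s => F r s * G r s).

Lemma polar_poly_sum (I : Type) (l : seq I) (F : I -> polar_fun R N) :
  (forall i, polar_poly (F i)) ->
  polar_poly (fun r s => \sum_(i <- l) F i r s).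
Proof.
move=> HF; elim: l => [|i l IH].
  rewrite (_ : (fun _ _ => _) = fun _ _ => 0); first exact: polar_cst.
  by apply/funext => r; apply/funext => s; rewrite big_nil.
rewrite (_ : (fun _ _ => _) = fun r s => F i r s + \sum_(i <- l) F i r s).
  exact: polar_add.
by apply/funext => r; apply/funext => s; rewrite big_cons.
Qed.

Lemma polar_poly_deriv F : polar_poly F -> exists2 G, polar_poly G &
  forall s r, 0 < r -> has_deriv (F^~ s) r (G r s).
Proof.
elim=> [w|i||c|{}F G _ [F' F'p dF] _ [G' G'p dG]|{}F G Fp [F' F'p dF] Gp [G' G'p dG]].
- exists (fun r s => \sum_(i <- index_enum 'I_N)
      tnth s i * in_polar (iter_partial (i :: w)) r s).
    apply: polar_poly_sum => i; apply: polar_mul; first exact: polar_coord.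
    exact: polar_partial.
  move=> s r r0; apply: has_deriv_eq.
    apply: (@has_deriv_ray _ _ (iter_partial w) (\row_i tnth s i)).
      by move=> y i; have [_ H] := su w; exact: H.
    by move=> i; have [H _] := su (i :: w).
  by apply: eq_bigr => i _; rewrite mxE.
- by exists (fun _ _ => 0); [exact: polar_cst|move=> s r _; exact: has_deriv_cst].
- exists (fun r _ => 1 + (-1) * (coth r * coth r)).
    apply: polar_add; first exact: polar_cst.
    apply: polar_mul; first exact: polar_cst.
    by apply: polar_mul; exact: polar_coth.
  move=> s r r0; apply: has_deriv_eq; first exact: has_deriv_coth.
  by rewrite mulN1r -expr2.
- by exists (fun _ _ => 0); [exact: polar_cst|move=> s r _; exact: has_deriv_cst].
- exists (fun r s => F' r s + G' r s); first exact: polar_add.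
  by move=> s r r0; apply: has_derivD; [exact: dF|exact: dG].
- exists (fun r s => F' r s * G r s + F r s * G' r s).
    by apply: polar_add; exact: polar_mul.
  by move=> s r r0; apply: has_derivM; [exact: dF|exact: dG].
Qed.

Lemma polar_poly_measurable F : polar_poly F ->
  measurable_fun half (fun p => F p.1 p.2).
Proof.
elim=> [w|i||c|{}F G _ mF _ mG|{}F G _ mF _ mG].
- rewrite /in_polar.
  rewrite (_ : (fun _ => _) = fun p : R * N.-tuple R =>
    iter_partial w (\row_i (p.1 * tnth p.2 i))).
    apply: measurable_continuous_row; first exact: measurable_half.
      move=> i; apply: measurable_funM; last exact: measurable_coord.
      by apply: (@measurable_on_half R N (fun r => r)) => r _; exact: cvg_id.
    by have [] := su w.
  by apply/funext => p; congr iter_partial; apply/rowP => i; rewrite !mxE.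
- exact: measurable_coord.
- apply: (@measurable_on_half R N (@coth R)) => r r0.
  exact: has_deriv_continuous (has_deriv_coth r0).
- exact: measurable_cst.
- exact: measurable_funD.
- exact: measurable_funM.
Qed.

(** Partial derivatives of u are continuous, hence bounded on a cube that contains
    the ball of radius b; coth r is at most e^b / sinh a. *)
Lemma polar_poly_bounded F (a b : R) : 0 < a -> polar_poly F ->
  exists M, forall r s, a <= r <= b -> tuple_norm s = 1 -> `|F r s| <= M.
Proof.
move=> a0; elim=> [w|i||c|{}F G _ [M HM] _ [L HL]|{}F G _ [M HM] _ [L HL]].
- have cK : compact [set x : 'rV[R]_N | forall i, `[- b, b]%classic (x 0 i)].
    by apply: (@rV_compact _ _ (fun=> `[- b, b]%classic)) => _; exact: segment_compact.
  have [cw _] := su w.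
  have := continuous_compact (continuous_subspaceT cw) cK.
  move=> /compact_bounded[M [_ HM]].
  exists (M + 1) => r s /andP[ar rb] s1; apply: HM; first by rewrite ltrDl.
  exists (r *: \row_i tnth s i) => // i; rewrite /= !mxE in_itv/= -ler_norml.
  have r0 := lt_le_trans a0 ar.
  by rewrite normrM (gtr0_norm r0) (le_trans _ rb)// ler_piMr ?(ltW r0) ?tuple_norm1_le.
- by exists 1 => r s _; exact: tuple_norm1_le.
- exists (expR b / sinh a) => r s /andP[ar rb] _.
  have sa := sinh_gt0 a0; have r0 := lt_le_trans a0 ar.
  have sr := sinh_gt0 r0.
  rewrite /coth gtr0_norm; last exact: divr_gt0 (cosh_gt0 r) sr.
  apply: ler_pM.
  + exact/ltW/cosh_gt0.
  + by rewrite invr_ge0 ltW.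
  + have e1 : expR r <= expR b by rewrite ler_expR.
    have e2 : expR (- r) <= expR r by rewrite ler_expR; lra.
    by rewrite /cosh; lra.
  + rewrite lef_pV2 ?posrE// /sinh.
    have e1 : expR a <= expR r by rewrite ler_expR.
    have e2 : expR (- r) <= expR (- a) by rewrite ler_expR; lra.
    by lra.
- by exists `|c|.
- exists (M + L) => r s rab s1.
  by apply: le_trans (ler_normD _ _) _; rewrite lerD ?HM ?HL.
- exists (M * L) => r s rab s1.
  by rewrite normrM; apply: ler_pM => //; [exact: HM|exact: HL].
Qed.

(** Iterated derivatives are taken of functions defined for all real r, where the
    formulas of [polar_poly] may fail at r <= 0; equality on the open half-line
    determines all derivatives there. *)
Definition polar_smooth F :=
  exists2 F0, polar_poly F0 & forall r s, 0 < r -> F r s = F0 r s.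

Lemma polar_smooth_has_deriv F : polar_smooth F ->
  forall s r, 0 < r -> has_deriv (F^~ s) r (radial_deriv F r s).
Proof.
move=> [F0 F0p FE] s r r0; have [G _ /(_ s r r0) dG] := polar_poly_deriv F0p.
apply: derivable_has_deriv; apply: (@has_deriv_derivable _ _ _ (G r s)).
apply: has_deriv_near dG; apply: filterS (lt_nbhsr r0) => t t0.
by rewrite FE.
Qed.

Lemma polar_smooth_deriv F : polar_smooth F -> polar_smooth (radial_deriv F).
Proof.
move=> [F0 F0p FE]; have [G Gp dG] := polar_poly_deriv F0p; exists G => // r s r0.
apply: has_deriv_val; apply: has_deriv_near (dG s r r0).
by apply: filterS (lt_nbhsr r0) => t t0; rewrite FE.
Qed.

Lemma polar_smooth_laplacian F : polar_smooth F -> polar_smooth (radial_laplacian F).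
Proof.
move=> Fp; have [F1 F1p F1E] := polar_smooth_deriv Fp.
have [F2 F2p F2E] := polar_smooth_deriv (polar_smooth_deriv Fp).
exists (fun r s => F2 r s + (N%:R - 1) * coth r * F1 r s).
  apply: polar_add => //; apply: (polar_mul _ F1p).
  by apply: polar_mul; [exact: polar_cst|exact: polar_coth].
by move=> r s r0; rewrite /radial_laplacian F2E// F1E.
Qed.

Lemma polar_smooth_iter j : polar_smooth (iter j (@radial_laplacian R N) (in_polar u)).
Proof.
elim: j => [|j IH]; last exact: polar_smooth_laplacian.
by exists (in_polar u) => //; exact: (polar_partial [::]).
Qed.

Lemma polar_smooth_measurable F : polar_smooth F ->
  measurable_fun half (fun p => F p.1 p.2).
Proof.
move=> [F0 F0p FE]; apply: eq_measurable_fun (polar_poly_measurable F0p).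
by move=> p; rewrite inE => p0; rewrite FE.
Qed.

End polar_class.

(** * Integration in polar coordinates *)

Section ray_integral.
Context {R : realType}.
Local Notation mu := (@lebesgue_measure R).
Local Notation pos := [set r : R | 0 < r].
Implicit Types f g : R -> R.

Lemma posE : pos = `]0, +oo[%classic.
Proof. by apply/seteqP; split => r /=; rewrite in_itv/= andbT. Qed.

Lemma measurable_pos : measurable pos.
Proof. by rewrite posE. Qed.

Lemma supported_derive1 (a b : R) f : supported_in a b f -> supported_in a b (derive1 f).
Proof.
move=> sf r r0 rab; apply: has_deriv_val.
apply: (has_deriv_near _ (has_deriv_cst r 0)).
move: rab => /orP[ra|br].
  by apply: filterS2 (lt_nbhsr r0) (lt_nbhsl ra) => t t0 ta; rewrite sf// ta.
by apply: filterS2 (lt_nbhsr r0) (lt_nbhsr br) => t t0 ta; rewrite sf// ta orbT.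
Qed.

(** The support is enlarged to a segment [c, d] of the open half-line such that f
    vanishes at c and d. *)
Lemma C1c_integral_deriv f : C1c f ->
  mu.-integrable pos (EFin \o derive1 f) /\
  (\int[mu]_(r in pos) (derive1 f r)%:E = 0)%E.
Proof.
move=> fC; have [[a [b [a0 [ab sf]]]] df cf] := fC.
(* A segment of the open half-line whose interior contains the support. *)
pose c := a / 2; pose d := b + 1.
have c0 : 0 < c by rewrite /c divr_gt0.
have ca : c < a by rewrite /c; lra.
have bd : b < d by rewrite /d; lra.
have cd : c < d by lra.
have cdpos : `[c, d]%classic `<=` pos.
  by move=> r /=; rewrite in_itv/= => /andP[cr _]; exact: lt_le_trans cr.
have cw : {within `[c, d]%classic, continuous (derive1 f)}.
  by apply: continuous_in_subspaceT => r; rewrite inE => /cdpos; exact: cf.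
have ic : mu.-integrable `[c, d]%classic (EFin \o derive1 f).
  by apply: continuous_compact_integrable => //; exact: segment_compact.
have E : forall r, pos r -> (derive1 f r)%:E = ((EFin \o derive1 f) \_ `[c, d]%classic) r.
  move=> r r0; rewrite patchE; case: ifPn => //.
  rewrite notin_setE /= in_itv/= => /negP; rewrite negb_and -!ltNge => /orP[rc|dr].
    by rewrite (supported_derive1 sf)// (lt_trans rc ca).
  by rewrite (supported_derive1 sf)// (lt_trans bd dr) orbT.
split.
  apply: (@eq_integrable _ _ _ mu _ measurable_pos
    ((EFin \o derive1 f) \_ `[c, d]%classic)).
    by move=> r; rewrite inE => /E <-.
  apply: integrableS ((integrable_mkcond _ _).1 ic) => //; exact: measurable_pos.
transitivity (\int[mu]_(r in pos) ((EFin \o derive1 f) \_ `[c, d]%classic) r)%E.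
  by apply: eq_integral => r; rewrite inE => /E.
rewrite -integral_mkcondr setIidr//.
rewrite /= (@continuous_FTC2 _ _ f)//.
  by rewrite !sf ?ca ?bd ?orbT// ?subee//; lra.
have cvr r : 0 < r -> {for r, continuous f} by exact: C1c_cont.
split.
- by move=> r; rewrite in_itv/= => /andP[cr _]; apply: df; exact: lt_trans cr.
- by apply: cvg_at_right_filter; exact: cvr.
- by apply: cvg_at_left_filter; apply: cvr; lra.
Qed.

(** If the integral of g is finite, so is that of g - Phi', and both are equal;
    otherwise there is nothing to prove. *)
Lemma ile_integral f g :
  (forall r, 0 < r -> 0 <= f r) -> (forall r, 0 < r -> 0 <= g r) ->
  measurable_fun pos f -> measurable_fun pos g -> ile f g ->
  (\int[mu]_(r in pos) (f r)%:E <= \int[mu]_(r in pos) (g r)%:E)%E.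
Proof.
move=> f0 g0 mf mg [Phi [PC H]].
have [iP P0] := C1c_integral_deriv PC.
have mP := measurable_pos.
have [->|gfin] := eqVneq (\int[mu]_(r in pos) (g r)%:E)%E +oo%E; first exact: leey.
have ig : mu.-integrable pos (EFin \o g).
  apply/integrableP; split; first exact/measurable_EFinP.
  under eq_integral => r do [rewrite inE /= => r0; rewrite (ger0_norm (g0 _ r0))].
  by rewrite ltey.
rewrite -[leRHS]sube0 -P0 -integralB_EFin//.
apply: ge0_le_integral => //.
- exact/measurable_EFinP.
- apply: emeasurable_funB; first exact/measurable_EFinP.
  by case/integrableP: iP.
- by move=> r r0; rewrite -EFinB lee_fin lerBrDr H.
Qed.

End ray_integral.

Section polar_integral.
Context {R : realType} {N : nat}.
Local Notation mu := (@lebesgue_measure R).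
Local Notation sigma := (sphere_measure R N).
Local Notation pos := [set r : R | 0 < r].
Local Notation half := [set p : R * N.-tuple R | 0 < p.1].
Local Notation sphere := [set s : N.-tuple R | tuple_norm s = 1].
Implicit Types F G : polar_fun R N.

Definition polar_measurable F := measurable_fun half (fun p => F p.1 p.2).
Definition polar_nonneg F := forall r s, 0 < r -> 0 <= F r s.

Lemma measurable_sphere : measurable sphere.
Proof.
rewrite (_ : sphere = @tuple_norm R N @^-1` [set 1]).
  by rewrite -[X in measurable X]setTI; apply: measurable_tuple_norm.
by apply/seteqP; split.
Qed.

(** The direction of a point of the punctured ball has norm 1. *)
Lemma sphere_measure_sphereC : sigma (~` sphere) = 0%E.
Proof.
rewrite /sphere_measure (_ : _ `&` _ = set0) ?measure0 ?mule0//.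
apply/seteqP; split => // t [/= H /andP[t0 _]]; apply: H.
rewrite /tuple_norm.
under eq_bigr do rewrite tnth_mktuple expr_div_n.
rewrite -mulr_suml -sqrtr1; congr Num.sqrt.
have E : tuple_norm t ^+ 2 = \sum_(i < N) tnth t i ^+ 2.
  by rewrite sqr_sqrtr// sumr_ge0// => i _; exact: sqr_ge0.
by rewrite -E divff// expf_neq0// gt_eqF.
Qed.

Definition ray_integral F (s : N.-tuple R) : \bar R :=
  (\int[mu]_(r in pos) (F r s)%:E)%E.

Lemma polar_measurable_ray F s : polar_measurable F ->
  measurable_fun pos (F^~ s).
Proof.
move=> mF; rewrite (_ : F^~ s = (fun p => F p.1 p.2) \o (pair^~ s)); last exact/funext.
apply: (measurable_comp measurable_half) => //.
- by move=> _ [r r0 <-].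
- by apply: measurable_funTS; exact: pair2_measurable.
Qed.

(** Tonelli's theorem, the inner integral being along rays; directions off the
    unit sphere form a null set. *)
Lemma polar_tonelli F : polar_measurable F -> polar_nonneg F ->
  measurable_fun sphere (ray_integral F) /\
  (\int[mu \x sigma]_(p in half) (F p.1 p.2)%:E =
   \int[sigma]_(s in sphere) ray_integral F s)%E.
Proof.
move=> mF F0.
pose H := (fun p => (F p.1 p.2)%:E) \_ half.
have mH : measurable_fun setT H.
  apply/(measurable_restrictT _ measurable_half); exact/measurable_EFinP.
have H0 p : (0 <= H p)%E.
  by rewrite /H patchE; case: ifPn => //; rewrite inE lee_fin => /F0.
have HE s : (\int[mu]_r H (r, s) = ray_integral F s)%E.
  rewrite /ray_integral [RHS]integral_mkcond; apply: eq_integral => r _.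
  by rewrite /H !patchE; congr (if _ then _ else _); rewrite !(inE, in_setE).
have mG := measurable_fun_fubini_tonelli_G (m1 := mu) H mH H0.
have mR : measurable_fun setT (ray_integral F).
  by apply: eq_measurable_fun mG => s _; exact: HE.
split; first exact: measurable_funTS.
rewrite integral_mkcond -/H (fubini_tonelli2 (m1 := mu) (m2 := sigma) H mH H0).
transitivity (\int[sigma]_s ray_integral F s)%E.
  by apply: eq_integral => s _; exact: HE.
rewrite (ge0_negligible_integral (measurableC measurable_sphere) measurableT mR)//.
- by rewrite setTD setCK.
- by move=> s _; apply: integral_ge0 => r r0; rewrite lee_fin F0.
- exact: sphere_measure_sphereC.
Qed.

Lemma le_polar_integral F G : polar_measurable F -> polar_nonneg F ->
  polar_measurable G -> polar_nonneg G ->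
  (forall s, tuple_norm s = 1 -> (ray_integral F s <= ray_integral G s)%E) ->
  (\int[mu \x sigma]_(p in half) (F p.1 p.2)%:E <=
   \int[mu \x sigma]_(p in half) (G p.1 p.2)%:E)%E.
Proof.
move=> mF F0 mG G0 FG; have [mF' ->] := polar_tonelli mF F0.
have [mG' ->] := polar_tonelli mG G0.
apply: ge0_le_integral => //; first exact: measurable_sphere.
by move=> s _; apply: integral_ge0 => r r0; rewrite lee_fin F0.
Qed.

Lemma polar_integral_finite F (a b M : R) : polar_measurable F -> polar_nonneg F ->
  (forall s, tuple_norm s = 1 -> supported_in a b (F^~ s)) ->
  (forall r s, a <= r <= b -> tuple_norm s = 1 -> F r s <= M) ->
  (\int[mu \x sigma]_(p in half) (F p.1 p.2)%:E < +oo)%E.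
Proof.
move=> mF F0 sF FM; have [mF' ->] := polar_tonelli mF F0.
have M0 : 0 <= `|M| by exact: normr_ge0.
have H s : sphere s -> (ray_integral F s <= `|M|%:E * mu `[a, b]%classic)%E.
  move=> s1; apply: (@le_trans _ _
    (\int[mu]_(r in pos) (cst (`|M|%:E) \_ `[a, b]%classic) r)%E).
    apply: ge0_le_integral => //.
    - exact: measurable_pos.
    - by move=> r r0; rewrite lee_fin F0.
    - by apply/measurable_EFinP; exact: polar_measurable_ray.
    - apply: measurable_funTS; apply/(measurable_restrictT _ _).1 => //.
    - move=> r r0; rewrite patchE; case: ifPn => [|/negP].
        rewrite inE /= in_itv/= => rab; rewrite lee_fin.
        by rewrite (le_trans (FM _ _ rab s1))// ler_norm.
      rewrite inE /= in_itv/= => /negP; rewrite negb_and -!ltNge => rab.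
      by rewrite (sF s s1 r r0 rab).
  have mpab : measurable (pos `&` `[a, b]%classic).
    by apply: measurableI => //; exact: measurable_pos.
  by rewrite -integral_mkcondr integral_cst// lee_wpmul2l// le_measure// ?inE.
apply: (@le_lt_trans _ _
  (\int[sigma]_(s in sphere) (cst (`|M|%:E * mu `[a, b]%classic)%E s))%E).
  apply: ge0_le_integral => //; first exact: measurable_sphere.
  by move=> s _; apply: integral_ge0 => r r0; rewrite lee_fin F0.
rewrite integral_cst; last exact: measurable_sphere.
have mab : mu `[a, b]%classic \is a fin_num.
  by rewrite lebesgue_measure_itv; case: ifP => _; rewrite -?EFinB.
have ms : sigma sphere \is a fin_num.
  by apply: fin_num_measure; exact: measurable_sphere.
apply: lte_mul_pinfty; first by rewrite mule_ge0.
  by rewrite fin_numM.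
by have : (sigma sphere < +oo)%E by rewrite ltey_eq ms.
Qed.

End polar_integral.

(** * Supports and assembly *)

Section support.
Context {R : realType} {N : nat}.
Implicit Types (F : polar_fun R N) (u : 'rV[R]_N -> R).

Definition polar_supported (a b : R) F :=
  forall s, tuple_norm s = 1 -> supported_in a b (F^~ s).

Lemma sum_sqr_sphere (s : N.-tuple R) : tuple_norm s = 1 ->
  \sum_(i < N) tnth s i ^+ 2 = 1.
Proof.
move=> s1; rewrite -[RHS](expr1n _ 2) -s1 sqr_sqrtr// sumr_ge0// => i _.
exact: sqr_ge0.
Qed.

Lemma coord_le_norm (x : 'rV[R]_N) i : `|x 0 i| <= `|x|.
Proof.
rewrite [leRHS]/Num.norm /= mx_normrE.
exact: (le_bigmax _ (fun ij => `|x ij.1 ij.2|) (0, i)).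
Qed.

(** The support of u avoids a ball of radius a about 0, and on it the coordinates
    are bounded by some M; r s in the support with |s| = 1 implies r^2 <= N M^2, and
    r <= r^2 when r >= 1. *)
Lemma Cc_polar_supported u : Cc_infty_punctured u ->
  exists a b, 0 < a /\ a < b /\ polar_supported a b (in_polar u).
Proof.
move=> [_ cK K0]; set K := closure _ in cK K0.
have uK x : ~ K x -> u x = 0.
  by move=> Kx; apply: contrapT => /eqP ux; apply: Kx; exact: subset_closure.
have [M [_ HM]] := compact_bounded cK.
have : nbhs (0 : 'rV[R]_N) (~` K).
  by apply: open_nbhs_nbhs; split => //; apply: closed_openC; exact: closed_closure.
move=> /nbhs_ballP[a /= a0 aK].
pose M1 := `|M| + 1.
exists a, (N%:R * M1 ^+ 2 + 1 + a); split=> //; split.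
  by rewrite ltrDr ltr_wpDl// mulr_ge0// sqr_ge0.
move=> s s1 r r0 /orP[ra|br]; apply: uK.
  apply: aK; split => // i0 i; rewrite ord1 !mxE /ball /= sub0r normrN normrM.
  by rewrite gtr0_norm// (le_lt_trans _ ra)// ler_piMr ?(ltW r0)// tuple_norm1_le.
move=> /(HM M1) /=; rewrite /M1 => /(_ _)-Hr.
have {}Hr : `|r *: (\row_i tnth s i : 'rV[R]_N)| <= M1.
  by apply: Hr; rewrite (le_lt_trans (ler_norm M))// ltrDl.
have r2 : r ^+ 2 <= N%:R * M1 ^+ 2.
  have -> : N%:R * M1 ^+ 2 = \sum_(i < N) M1 ^+ 2.
    by rewrite sumr_const card_ord mulr_natl.
  have -> : r ^+ 2 = \sum_(i < N) r ^+ 2 * tnth s i ^+ 2.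
    by rewrite -mulr_sumr sum_sqr_sphere// mulr1.
  apply: ler_sum => i _.
  rewrite -exprMn -[leLHS]ger0_norm ?sqr_ge0// normrX ler_pXn2r ?nnegrE//.
    2: exact: addr_ge0.
  by have := le_trans (coord_le_norm _ i) Hr; rewrite !mxE.
have NM : 0 <= N%:R * M1 ^+ 2 by rewrite mulr_ge0// sqr_ge0.
have r1 : 1 <= r by lra.
have : r <= r ^+ 2 by rewrite expr2; apply: ler_peMr => //; exact: ltW.
move=> /le_trans /(_ r2); rewrite leNgt => /negP; apply.
by apply: lt_trans br; rewrite -addrA ltrDl addr_gt0.
Qed.

Lemma polar_supported_deriv a b F : polar_supported a b F ->
  polar_supported a b (radial_deriv F).
Proof. by move=> sF s s1; apply: supported_derive1; exact: sF. Qed.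

Lemma polar_supported_laplacian a b F : polar_supported a b F ->
  polar_supported a b (radial_laplacian F).
Proof.
move=> sF s s1 r r0 rab; rewrite /radial_laplacian.
have sF1 := polar_supported_deriv sF.
by rewrite (polar_supported_deriv sF1)// sF1// mulr0 addr0.
Qed.

Lemma polar_supported_iter a b F j : polar_supported a b F ->
  polar_supported a b (iter j (@radial_laplacian R N) F).
Proof. by move=> sF; elim: j => // j IH; exact: polar_supported_laplacian. Qed.

End support.

Section rays.
Context {R : realType} {n : nat}.
Local Notation N := n.+1.
Variable u : 'rV[R]_N -> R.
Hypothesis cu : Cc_infty_punctured u.
Local Notation U j := (iter j (@radial_laplacian R N) (in_polar u)).

Let su : smooth u. Proof. by have [] := cu. Qed.

Lemma polar_C1c a b (F : polar_fun R N) s : 0 < a -> a < b ->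
  polar_smooth u F -> polar_supported a b F -> tuple_norm s = 1 -> C1c (F^~ s).
Proof.
move=> a0 ab pF sF s1.
apply: (@C1c_of _ _ (fun r => radial_deriv F r s)).
- by exists a, b; split=> //; split=> //; exact: sF.
- by move=> r r0; exact: (polar_smooth_has_deriv su pF s r0).
- move=> r r0; apply: has_deriv_continuous.
  exact: (polar_smooth_has_deriv su (polar_smooth_deriv su pF) s r0).
Qed.

Lemma lap_seq_ray s : tuple_norm s = 1 -> lap_seq n (fun j => (U j)^~ s).
Proof.
move=> s1 j; have [a [b [a0 [ab sU]]]] := Cc_polar_supported cu.
have pU := polar_smooth_iter su.
have sUj := polar_supported_iter j sU.
split.
- exact: (polar_C1c a0 ab).
- apply: (@polar_C1c a b (radial_deriv (U j))) => //.
    exact: polar_smooth_deriv.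
  exact: polar_supported_deriv.
- by move=> r r0; rewrite /= /radial_laplacian /radial_div -natr1 addrK.
Qed.

End rays.

Section hyp_integral.
Context {R : realType} {n : nat}.
Local Notation N := n.+1.
Implicit Types (F G : polar_fun R N).
Local Notation half := [set p : R * N.-tuple R | 0 < p.1].

Definition weighted F : polar_fun R N := fun r s => F r s * sinh r ^+ n.

Lemma weighted_nonneg F : polar_nonneg F -> polar_nonneg (weighted F).
Proof.
by move=> F0 r s r0; rewrite /weighted mulr_ge0 ?F0// exprn_ge0// ltW// sinh_gt0.
Qed.

Lemma weighted_measurable F : polar_measurable F -> polar_measurable (weighted F).
Proof.
move=> mF; apply: measurable_funM => //.
apply: (@measurable_on_half _ _ (fun r => sinh r ^+ n)) => r _.
exact: has_deriv_continuous (has_derivX n (has_deriv_sinh r)).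
Qed.

Lemma le_hyp_integral F G : polar_measurable F -> polar_nonneg F ->
  polar_measurable G -> polar_nonneg G ->
  (forall s, tuple_norm s = 1 ->
    ile (fun r => weighted F r s) (fun r => weighted G r s)) ->
  (hyp_integral F <= hyp_integral G)%E.
Proof.
move=> mF F0 mG G0 FG.
have [mF' F0'] := (weighted_measurable mF, weighted_nonneg F0).
have [mG' G0'] := (weighted_measurable mG, weighted_nonneg G0).
apply: (@le_polar_integral _ _ (weighted F) (weighted G)) => // s s1.
apply: ile_integral; last exact: FG.
- by move=> r r0; exact: F0'.
- by move=> r r0; exact: G0'.
- exact: polar_measurable_ray.
- exact: polar_measurable_ray.
Qed.

Lemma hyp_integralD F G : polar_measurable F -> polar_nonneg F ->
  polar_measurable G -> polar_nonneg G ->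
  hyp_integral (fun r s => F r s + G r s) = (hyp_integral F + hyp_integral G)%E.
Proof.
move=> mF F0 mG G0; rewrite /hyp_integral -ge0_integralD.
- by apply: eq_integral => p _; rewrite -EFinD mulrDl.
- exact: measurable_half.
- by move=> p p0; rewrite lee_fin; exact: weighted_nonneg.
- by apply/measurable_EFinP; exact: weighted_measurable.
- by move=> p p0; rewrite lee_fin; exact: weighted_nonneg.
- by apply/measurable_EFinP; exact: weighted_measurable.
Qed.

Lemma hyp_integralZ c F : 0 <= c -> polar_measurable F -> polar_nonneg F ->
  hyp_integral (fun r s => c * F r s) = (c%:E * hyp_integral F)%E.
Proof.
move=> c0 mF F0; rewrite /hyp_integral -ge0_integralZl_EFin//.
- by apply: eq_integral => p _; rewrite -EFinM mulrA.
- exact: measurable_half.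
- by move=> p p0; rewrite lee_fin; exact: weighted_nonneg.
- by apply/measurable_EFinP; exact: weighted_measurable.
Qed.

Lemma hyp_integral_sum (l : seq nat) (c : nat -> R) (F : nat -> polar_fun R N) :
  (forall i, 0 <= c i) -> (forall i, polar_measurable (F i)) ->
  (forall i, polar_nonneg (F i)) ->
  [/\ polar_measurable (fun r s => \sum_(i <- l) c i * F i r s),
      polar_nonneg (fun r s => \sum_(i <- l) c i * F i r s) &
  hyp_integral (fun r s => \sum_(i <- l) c i * F i r s) =
  (\sum_(i <- l) (c i)%:E * hyp_integral (F i))%E].
Proof.
move=> c0 mF F0.
have mc i : polar_measurable (fun r s => c i * F i r s).
  by apply: measurable_funM; [exact: measurable_cst|exact: mF].
have nc i : polar_nonneg (fun r s => c i * F i r s).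
  by move=> r s r0; rewrite mulr_ge0// F0.
elim: l => [|i l [mS S0 IH]].
  have E : (fun r s => \sum_(i <- [::]) c i * F i r s) = (fun _ _ => 0) :> polar_fun R N.
    by apply/funext => r; apply/funext => s; rewrite big_nil.
  rewrite E big_nil; split=> //; first exact: measurable_cst.
  rewrite /hyp_integral; under eq_integral do rewrite mul0r.
  exact: integral0.
have E : (fun r s => \sum_(i <- i :: l) c i * F i r s) =
    (fun r s => c i * F i r s + \sum_(i <- l) c i * F i r s) :> polar_fun R N.
  by apply/funext => r; apply/funext => s; rewrite big_cons.
rewrite E big_cons; split.
- by apply: measurable_funD; [exact: mc|exact: mS].
- by move=> r s r0; rewrite addr_ge0 ?nc ?S0.
- by rewrite hyp_integralD// IH hyp_integralZ.
Qed.

End hyp_integral.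

Theorem theorem4p5 (R : realType) (N k l m h : nat)
  (hk : k = (2 * m + 1)%N) (hl : l = (2 * h + 1)%N) (hlk : (l < k)%N)
  (hN : (2 * k < N)%N) :
  exists C : nat -> R,
    [/\ forall i, (1 <= i <= k)%N -> 0 < C i,
        C k = 1 / 4 * Xi_zero N 2 ((k - 1) %/ 2),
        C 1%N = (if (m - h)%N != 1%N then
                   1 / 4 * Xi_top N 2 ((k - 1) %/ 2) +
                   (N%:R - 1) ^+ 2 / 4 * C1_pred_odd R N k l
                 else
                   (N%:R - 1) ^+ 3 / 2 ^+ 6 * Xi_top N 2 ((l - 1) %/ 2) +
                   1 / 4 * Xi_top N 2 ((l + 1) %/ 2)) &
        forall u : 'rV[R]_N -> R, Cc_infty_punctured u ->
          (hyp_integral (fun r s =>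
               (radial_deriv (iter m (@radial_laplacian R N) (in_polar u)) r s ^+ 2)%R)
           - (((N%:R - 1) / 2) ^+ (4 * (m - h)))%R%:E *
             hyp_integral (fun r s =>
               (radial_deriv (iter h (@radial_laplacian R N) (in_polar u)) r s ^+ 2)%R)
           >= \sum_(1 <= i < k.+1)
                (C i)%:E *
                hyp_integral (fun r s => (in_polar u r s ^+ 2 / r ^+ (2 * i))%R))%E].
Proof.
case: N hN => // n hN.
have n6 : (6 <= n)%N by lia.
have [C [C0 Ck C1 H]] := @ile_ray R n n6 k l m h hk hl hlk hN.
exists C; split=> // u cu.
have su : smooth u by have [] := cu.
have [a [b [a0 [ab sU]]]] := Cc_polar_supported cu.
pose U j := iter j (@radial_laplacian R n.+1) (in_polar u).
have pU j : polar_smooth u (U j) by exact: polar_smooth_iter.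
have sUj j : polar_supported a b (radial_deriv (U j)).
  by apply: polar_supported_deriv; exact: polar_supported_iter.
pose D i : polar_fun R n.+1 := fun r s => in_polar u r s ^+ 2 / r ^+ (2 * i).
pose G j : polar_fun R n.+1 := fun r s => radial_deriv (U j) r s ^+ 2.
have D0 i : polar_nonneg (D i).
  by move=> r s r0; rewrite /D divr_ge0 ?sqr_ge0// exprn_ge0// ltW.
have G0 j : polar_nonneg (G j) by move=> r s _; exact: sqr_ge0.
have mG j : polar_measurable (G j).
  apply: (@measurable_funX _ _ _ _ (fun p => radial_deriv (U j) p.1 p.2)).
  by apply: (polar_smooth_measurable su); exact: polar_smooth_deriv.
have mD i : polar_measurable (D i).
  apply: (@measurable_funM _ _ _ _ (fun p => in_polar u p.1 p.2 ^+ 2)).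
    apply: (@measurable_funX _ _ _ _ (fun p => in_polar u p.1 p.2)).
    exact: (polar_smooth_measurable su (pU 0%N)).
  apply: (@measurable_on_half _ _ (fun r => (r ^+ (2 * i))^-1)) => r r0.
  apply: has_deriv_continuous (has_derivV _ (has_derivX _ (has_deriv_id r))).
  by rewrite expf_neq0// gt_eqF.
have NE : n.+1%:R - 1 = n%:R :> R by rewrite -natr1 addrK.
rewrite NE -/(U m) -/(U h) -/(G m) -/(G h).
have K0 : 0 <= (n%:R / 2) ^+ (4 * (m - h)) :> R by rewrite exprn_ge0// divr_ge0.
have Gfin : (hyp_integral (G h) < +oo)%E.
  have [F0 F0p F0E] := polar_smooth_deriv su (pU h).
  have [M HM] := polar_poly_bounded su b a0 F0p.
  apply: (@polar_integral_finite _ _ (weighted (G h)) a b (M ^+ 2 * expR b ^+ n)).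
  - exact: weighted_measurable.
  - exact: weighted_nonneg.
  - by move=> s s1 r r0 rab; rewrite /weighted /G sUj// expr0n mul0r.
  move=> r s /[dup] rab /andP[ar rb] s1; have r0 := lt_le_trans a0 ar.
  rewrite /weighted /G F0E//; have FM := HM _ _ rab s1.
  have s0 := sinh_gt0 r0.
  have M0 : 0 <= M by exact: le_trans FM.
  have sb : sinh r <= expR b.
    have e1 : expR r <= expR b by rewrite ler_expR.
    have e2 := expR_gt0 (- r); have e3 := expR_gt0 r.
    by rewrite /sinh; lra.
  apply: ler_pM; first exact: sqr_ge0.
  - by rewrite exprn_ge0// ltW.
  - by rewrite -[leLHS]ger0_norm ?sqr_ge0// normrX lerXn2r// nnegrE.
  - by rewrite lerXn2r// nnegrE ?expR_ge0// ltW.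
(* The subtracted term must be finite, since oo - oo is -oo. *)
have Gf : hyp_integral (G h) \is a fin_num.
  rewrite ge0_fin_numE//; apply: integral_ge0 => p p0; rewrite lee_fin.
  exact: (@weighted_nonneg _ _ (G h)).
have [mS S0 SE] := @hyp_integral_sum R n (index_iota 1 k.+1) C D
  (fun i => ltW (C0 i)) mD D0.
pose S : polar_fun R n.+1 := fun r s => \sum_(1 <= i < k.+1) C i * D i r s.
pose K : R := (n%:R / 2) ^+ (4 * (m - h)).
have mK : polar_measurable (fun r s => K * G h r s).
  by apply: measurable_funM; [exact: measurable_cst|exact: mG].
have K0' : polar_nonneg (fun r s => K * G h r s).
  by move=> r s r0; apply: mulr_ge0 => //; exact: G0.
have main : (hyp_integral S + K%:E * hyp_integral (G h) <= hyp_integral (G m))%E.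
  rewrite -hyp_integralZ// -hyp_integralD//.
  apply: le_hyp_integral => //.
  - by apply: measurable_funD; [exact: mS|exact: mK].
  - by move=> r s r0; apply: addr_ge0; [exact: S0|exact: K0'].
  move=> s s1; have Hs := H _ (lap_seq_ray cu s1).
  apply: (ile_trans (ile_trans _ Hs)); apply: ile_le => r r0.
    rewrite /weighted /S /K mulrDl mulr_suml le_eqVlt; apply/orP; left; apply/eqP.
    congr (_ + _); last by rewrite /wsq /weight expr0 divr1 -mulrA.
    by apply: eq_bigr => i _; rewrite /wsq /weight /D -!mulrA [_^-1 * _]mulrC.
  by rewrite /wsq /weight expr0 divr1.
rewrite leeBrDr; first by rewrite -SE; exact: main.
by rewrite fin_numM.
Qed.
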